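(* Every cubic graph admits a $(3\frac12,\frac12)$-flow.
   Context: Graphs are finite and undirected; parallel edges are allowed, loops are not. A cubic graph is a graph in which every vertex has degree $3$. For real numbers $r\ge 2$ and $\alpha\ge 0$, an $(r,\alpha)$-bounded excess flow ($(r,\alpha)$-flow for short) in a directed graph $D=(V,E)$ is an assignment $f:E\to[1,r-1]$ such that for every vertex $x\in V$, $\left|\sum_{e\in E^+(x)}f(e)-\sum_{e\in E^-(x)}f(e)\right|\le\alpha$, where $E^+(x)$, respectively $E^-(x)$, is the set of edges directed from, respectively toward, $x$ in $D$. An undirected graph $G$ admits an $(r,\alpha)$-flow if some orientation of $G$ admits such a flow. Here $3\frac12=\frac72$. *)

(* Defs.v *)
From mathcomp Require Import all_boot all_order all_algebra.
From mathcomp Require Import reals.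

Set Implicit Arguments.
Unset Strict Implicit.
Unset Printing Implicit Defensive.

Import Order.TTheory GRing.Theory Num.Theory.
Local Open Scope ring_scope.

(* Edges form a type of their own, so distinct edges may have the same ends
   (parallel edges); every edge has two distinct ends, so there are no loops. *)
Record mgraph := MGraph {
  vertex : finType;
  edge : finType;
  ends : edge -> {set vertex};
  card_ends : forall e, #|ends e| = 2%N
}.

(* The number of edges at x is the degree of x because there are no loops. *)
Definition degree (G : mgraph) (x : vertex G) : nat :=
  #|[set e : edge G | x \in ends e]|.

Definition cubic (G : mgraph) : Prop := forall x : vertex G, degree x = 3%N.

Record digraph (V E : finType) := DiGraph { tail : E -> V; head : E -> V }.

Definition out_edges (V E : finType) (D : digraph V E) (x : V) : {set E} :=
  [set e | tail D e == x].

Definition in_edges (V E : finType) (D : digraph V E) (x : V) : {set E} :=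
  [set e | head D e == x].

Definition orientation (G : mgraph) (D : digraph (vertex G) (edge G)) : Prop :=
  forall e : edge G, ends e = [set tail D e; head D e].

(* Intended for 2 <= r and 0 <= alpha. *)
Definition bounded_excess_flow (R : realType) (V E : finType)
    (D : digraph V E) (r alpha : R) (f : E -> R) : Prop :=
  (forall e : E, 1 <= f e <= r - 1) /\
  (forall x : V,
     `| \sum_(e in out_edges D x) f e - \sum_(e in in_edges D x) f e | <= alpha).

Definition admits_bounded_excess_flow (R : realType) (G : mgraph)
    (r alpha : R) : Prop :=
  exists D : digraph (vertex G) (edge G),
    orientation D /\ exists f : edge G -> R, bounded_excess_flow D r alpha f.

(* Main.v *)
Require Import Defs.
From mathcomp Require Import all_boot all_order all_algebra.
From mathcomp Require Import reals.
From mathcomp Require Import zify ring lra.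
Set Implicit Arguments.
Unset Strict Implicit.
Unset Printing Implicit Defensive.

(* Write f = (g + 1) / 2 with g integral, 1 <= g <= 4.  Suppose that at every
   vertex one edge, called major, is directed in and the two minor edges out
   (colour true), or conversely (colour false).  Then the excess is at most 1/2
   at v as soon as the minor edges at v have total value at most that of the
   major one, the other inequality being automatic.  An edge major at both ends
   may get value 4 and one major at no end value 1, so the condition says that
   the vertices hooked on one another by edges that are major at one end only
   form trees with at most three vertices.

   Bridges can be ignored when directing edges, since everything on one side of
   a bridge may be reversed.  By the Tutte-Berge formula, applied in each block
   as in Petersen's theorem, there are disjoint cycles that miss only vertices
   incident with three bridges and vertices whose unique bridge leads away from
   the root of the component.  The cycles are directed, and the major edge of a
   vertex on a cycle is one of its two cycle edges, so that trees there are
   monochromatic runs.  A pairing of consecutive vertices along each cycle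
   yields runs of length at most two, except for one triple on some cycles of
   odd length.  A vertex off the cycles is paired with another one, or hooked on
   one, or hooked on the cycle at the far end of its bridge; only when it is the
   middle of a directed path of length two between cycles must it be hooked on
   an end of this path.  Minimising the number of such vertices keeps them away
   from the triples, and a 2-colouring argument leaves at most one hook on each
   run of length two. *)

(** * Pairs of involutions *)

(** The orbits of the group generated by [a] and [b] are cycles whose steps alternate between [a]
    and [b]. Each consists of two orbits of [c], exchanged by [a] as well as by [b], and [d] singles
    out one of the two. *)
Lemma fpfree_alternating (T : finType) (a b : T -> T) :
  involutive a -> involutive b ->
  (forall x, a x != x) -> (forall x, b x != x) ->
  exists d : T -> bool, forall x, d (a x) = ~~ d x /\ d (b x) = ~~ d x.
Proof.
move=> aK bK a0 b0; pose c x := a (b x).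
have c_inj : injective c by move=> x y /(inv_inj aK)/(inv_inj bK).
have cabc x : c (a (c x)) = a x by rewrite /c aK bK.
have cn_inj n : injective (iter n c).
  by elim: n => // n IHn x y /= /c_inj/IHn.
have acn n x : iter n c (a (iter n c x)) = a x.
  elim: n x => // n IHn x; rewrite iterSr [iter n.+1 c x]/= cabc; exact: IHn.
(* Moving halfway by [acn], an equality would make [a] (for even [n]) or [b] (for odd [n]) fix the
   point reached there. *)
have na n x : iter n c x != a x.
  apply/eqP => e; have [k [ek|ek]] : exists k, n = k + k \/ n = (k + k).+1.
  - exists n./2; rewrite addnn -{1 3}(odd_double_half n).
    by case: (odd n); [right | left].
  - move: e; rewrite ek -(acn k) iterD => e.
    have {}e : iter k c x = a (iter k c x) by apply: (cn_inj k).
    by move: (a0 (iter k c x)); rewrite -e eqxx.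
  - move: e; rewrite ek -(acn k) -addnS iterD => e.
    have {}e : c (iter k c x) = a (iter k c x) by apply: (cn_inj k).
    by move/(inv_inj aK): e => e; move: (b0 (iter k c x)); rewrite e eqxx.
have rc x : froot c (c x) = froot c x.
  by apply/esym/eqP; rewrite root_connect ?fconnect1 //; apply: fconnect_sym.
have rac x : froot c (a (c x)) = froot c (a x) by rewrite -(rc (a (c x))) cabc.
have rb x : froot c (b x) = froot c (a x) by rewrite -(rac x) /c aK.
have rab x : froot c (a (b x)) = froot c x by rewrite -[RHS]rc.
have ra x : froot c (a x) != froot c x.
  rewrite root_connect; last exact: fconnect_sym.
  rewrite fconnect_sym //; apply/negP=> /iter_findex e.
  by move: (na (findex c x (a x)) x); rewrite e eqxx.
pose d x := enum_rank (froot c x) < enum_rank (froot c (a x)).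
have dn x : ~~ d x = (enum_rank (froot c (a x)) < enum_rank (froot c x)).
  rewrite /d -leqNgt leq_eqVlt orbC -[RHS]orbF; congr (_ || _).
  by apply/negbTE; rewrite val_eqE (inj_eq enum_rank_inj).
by exists d => x; split; rewrite dn /d ?aK ?rb ?rab.
Qed.

(* Fixed points of each involution are removed by doubling [T]. *)
Lemma two_involutions (T : finType) (a b : T -> T) :
  involutive a -> involutive b ->
  exists d : T -> bool, forall x,
    (a x != x -> d (a x) = ~~ d x) /\ (b x != x -> d (b x) = ~~ d x).
Proof.

move=> aK bK.
pose a2 (x : T * bool) := if a x.1 == x.1 then (x.1, ~~ x.2) else (a x.1, x.2).
pose b2 (x : T * bool) := if b x.1 == x.1 then (x.1, ~~ x.2) else (b x.1, x.2).
have K2 (f : T -> T) : involutive f ->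
    involutive (fun x : T * bool =>
      if f x.1 == x.1 then (x.1, ~~ x.2) else (f x.1, x.2)).
  move=> fK [x i] /=; case: (eqVneq (f x) x) => [e|ne] /=.
    by rewrite e eqxx negbK.
  by rewrite fK eq_sym (negbTE ne).
have N2 (f : T -> T) (x : T * bool) :
    (if f x.1 == x.1 then (x.1, ~~ x.2) else (f x.1, x.2)) != x.
  case: x => x i /=; case: (eqVneq (f x) x) => [e|ne] /=; rewrite xpair_eqE.
    by rewrite eqxx; case: i.
  by rewrite (negbTE ne).
have [d dP] := fpfree_alternating (K2 a aK) (K2 b bK) (N2 a) (N2 b).
exists (fun x => d (x, false)) => x; case: (dP (x, false)) => /= da db.
by split=> ne; [move: da | move: db]; rewrite (negbTE ne).
Qed.

(** An alternating colouring of the pairs of [m] splits [A] into two halves exchanged by [m]. *)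
Lemma card_involution_even (T : finType) (A : {pred T}) (m : T -> T) :
  involutive m -> (forall x, x \in A -> m x != x) ->
  (forall x, x \in A -> m x \in A) -> ~~ odd #|A|.
Proof.
move=> mK m0 mA.
have [d dP] := two_involutions mK mK.
rewrite -(cardID [pred x | d x] A).
suff -> : #|[predD A & [pred x | d x]]| = #|[predI A & [pred x | d x]]|.
  by rewrite addnn odd_double.
rewrite -(card_image (inv_inj mK)); apply: eq_card => x.
rewrite !inE; apply/imageP/andP => [[y] /[!inE] /andP[dy yA] ->|[xA dx]].
  by rewrite mA // (dP y).1 ?m0 // dy.
exists (m x); last by rewrite mK.
by rewrite !inE mA // (dP x).1 ?m0 // dx.
Qed.

(* The elements of an orbit are paired off in order of traversal, starting just
   after the element of [B] if there is one; an orbit of odd length leaves its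
   last element unpaired. *)
Lemma near_perfect_pairing (T : finType) (p q : T -> T) (B : {pred T}) :
  cancel p q -> cancel q p ->
  (forall x y, x \in B -> y \in B -> fconnect p x y -> x = y) ->
  exists N : T -> T,
    [/\ involutive N,
        forall x, N x = x \/ N x = p x \/ N x = q x,
        forall x y, N x = x -> N y = y -> fconnect p x y -> x = y
      & forall x y, N x = x -> y \in B -> fconnect p x y -> x = y].
Proof.
move=> pK qK Buniq; have p_inj := can_inj pK.
pose base x := p (odflt (froot p x) [pick y in B | fconnect p x y]).
have base_eq x y : fconnect p x y -> base x = base y.
  move=> xy; rewrite /base.
  have -> : froot p x = froot p y by apply/eqP; rewrite root_connect //; apply: fconnect_sym.
  congr (p (odflt _ _)); apply: eq_pick => z /=.
  by rewrite (same_connect (fconnect_sym p_inj) xy).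
have con_base x : fconnect p (base x) x.
  rewrite fconnect_sym // /base; apply: connect_trans (fconnect1 _ _).
  by case: pickP => [y /andP[]//|_] /=; rewrite connect_root.
pose i x := findex p (base x) x.
pose L x := order p (base x).
have iK x : iter (i x) p (base x) = x by apply: iter_findex.
have iL x : i x < L x by apply: findex_max.
have ip x : (i x).+1 < L x -> i (p x) = (i x).+1.
  move=> lt; have e : p x = iter (i x).+1 p (base x) by rewrite iterS iK.
  by rewrite {1}/i -(base_eq x (p x)) ?fconnect1 // e findex_iter.
have Lp x : L (p x) = L x by rewrite /L (base_eq x (p x)) ?fconnect1.
have Lq x : L (q x) = L x by rewrite -{2}(qK x) Lp.
have iq x : 0 < i x -> i (q x) = (i x).-1.
  move=> gt0; have e : q x = iter (i x).-1 p (base x).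
    by apply: p_inj; rewrite qK -iterS prednK // iK.
  rewrite {1}/i (base_eq (q x) x); last by rewrite -{2}(qK x) fconnect1.
  by rewrite e findex_iter //; apply: leq_ltn_trans (iL x); exact: leq_pred.
(* Positions count from 0: an odd one is paired with its predecessor, an even one with its successor
   if there is one. *)
pose N x := if odd (i x) then q x else if (i x).+1 < L x then p x else x.
have Nfix x : N x = x -> ~~ odd (i x) -> (i x).+1 = L x.
  rewrite /N => + /negbTE ev; rewrite ev; case: ltnP => [lt e|le _].
    by move: (ip x lt); rewrite e => /eqP; rewrite eqn_leq ltnn andbF.
  by apply/eqP; rewrite eqn_leq iL.
have Nodd x : N x = x -> ~~ odd (i x).
  rewrite /N; case: ifP => // od e; have := iq x; rewrite e.
  case: (i x) od => // n _ /(_ isT) /= /eqP; by rewrite eqn_leq ltnn.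
have Nbase x : N x = x -> p x = base x.
  move=> e; have ev := Nodd x e; have {e ev} eL := Nfix x e ev.
  by rewrite -{1}(iK x) -iterS eL iter_order.
exists N; split.
- move=> x; rewrite /N; case: (boolP (odd (i x))) => od.
    have gt0 : 0 < i x by case: (i x) od.
    rewrite iq // -subn1 oddB // od /= Lq subn1 prednK // iL; exact: qK.
  case: ltnP => [lt|le]; first by rewrite ip //= od pK.
  by rewrite (negbTE od) ltnNge le.
- by move=> x; rewrite /N; case: ifP => _; [right; right | case: ifP => _; [right; left | left]].
- move=> x y ex ey xy; apply: p_inj.
  by rewrite (Nbase x ex) (Nbase y ey) (base_eq x y xy).
- move=> x y ex yB xy; apply: p_inj; rewrite (Nbase x ex) /base.
  case: pickP => [z /andP[zB xz]|/(_ y)] /=; last by rewrite yB xy.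
  congr p; apply: Buniq => //; apply: connect_trans xy.
  by rewrite (fconnect_sym (can_inj pK)).
Qed.

(** * Matchings and odd barriers *)

Section Matchings.
Variables (T : finType) (adj : rel T).
Hypothesis adj_sym : symmetric adj.
Implicit Types (A B S : {set T}) (m : {ffun T -> T}).

Definition covered m : {set T} := [set x | m x != x].

(** A matching is encoded as the involution that exchanges matched vertices and fixes all others. *)
Definition matching A m :=
  [forall x, m (m x) == x] && [forall x in covered m, (x \in A) && adj x (m x)].

(** This counts covered vertices, hence twice the usual number of edges; [#|A| - matching_number A]
    is the deficiency. *)
Definition matching_number A := \max_(m | matching A m) #|covered m|.

Definition maximum_matching A m :=
  matching A m && (#|covered m| == matching_number A).

Lemma matchingP A m :
  reflect (involutive m /\ forall x, m x != x -> x \in A /\ adj x (m x))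
          (matching A m).
Proof.
apply: (iffP andP) => [[/forallP mK /forall_inP mA]|[mK mA]]; split.
- by move=> x; apply/eqP.
- by move=> x mx; apply/andP; apply: mA; rewrite inE.
- by apply/forallP=> x; rewrite mK.
- by apply/forall_inP=> x /[!inE] /mA[-> ->].
Qed.

Lemma covered_sub A m : matching A m -> covered m \subset A.
Proof. by case/matchingP=> _ mA; apply/subsetP=> x /[!inE] /mA[]. Qed.

Lemma matching_sub A B m : A \subset B -> matching A m -> matching B m.
Proof.
move=> /subsetP AB /matchingP[mK mA]; apply/matchingP; split=> // x /mA[xA ->].
by rewrite AB.
Qed.

Lemma matching_number_max A m :
  matching A m -> #|covered m| <= matching_number A.
Proof. by move=> mA; apply: (@leq_bigmax_cond _ (matching A)). Qed.

Lemma maximum_matching_exists A : exists m, maximum_matching A m.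
Proof.
have m0 : matching A [ffun x => x].
  by apply/matchingP; split=> x; rewrite !ffunE // eqxx.
have [|m mA e] := @eq_bigmax_cond _ (matching A) (fun m => #|covered m|).
  by apply/card_gt0P; exists [ffun x => x].
by exists m; rewrite /maximum_matching (mA : matching A m) -e eqxx.
Qed.

Lemma covered_even A m : matching A m -> ~~ odd #|covered m|.
Proof.
case/matchingP=> mK _; apply: (card_involution_even mK) => x; rewrite !inE //.
by rewrite mK eq_sym.
Qed.

(* Gallai's argument: a maximum matching missing [t] that agrees most with a
   maximum matching missing [u] and [v] can be improved. *)
Lemma gallai_transitive A u t v :
  (exists2 m, maximum_matching A m & m t = t) ->
  (forall m, maximum_matching A m -> m u = u -> m t != t) ->
  (forall m, maximum_matching A m -> m t = t -> m v != v) ->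
  u != v -> forall m, maximum_matching A m -> m u = u -> m v != v.
Proof.
move=> [N0 N0max N0t] ut tv uv M Mmax Mu; apply/eqP => Mv.
have [/matchingP[MK MA] Mcard] := andP Mmax.
pose agree N := [set x | (M x != x) && (M x == N x)].
have [N /andP[Nmax /eqP Nt] Nbest] :=
  @arg_maxnP _ N0 (fun N : {ffun T -> T} => maximum_matching A N && (N t == t))
    (fun N : {ffun T -> T} => #|agree N|) (introT andP (conj N0max (introT eqP N0t))).
have [/matchingP[NK NA] Ncard] := andP Nmax.
have Nu : N u != u by apply/eqP => Nu; move: (ut N Nmax Nu); rewrite Nt eqxx.
have Nv := tv N Nmax Nt.
(* [M] and [N] cover equally many vertices, and [N] covers [u] and [v], which [M] misses; so at
   least two vertices are covered by [M] alone. *)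
have [x xM xt] : exists2 x, x \in covered M :\: covered N & x != t.
  have c : 1 < #|covered N :\: covered M|.
    rewrite (leq_trans _ (subset_leq_card (_ : [set u; v] \subset _))) ?cards2 ?uv //.
    by apply/subsetP => z /[!inE] /orP[]/eqP->; rewrite ?Mu ?Mv ?eqxx ?Nu ?Nv.
  have {}c : 1 < #|covered M :\: covered N|.
    have := cardsID (covered M) (covered N); have := cardsID (covered N) (covered M).
    by rewrite setIC (eqP Mcard) (eqP Ncard); lia.
  have : 0 < #|(covered M :\: covered N) :\ t|.
    by have := cardsD1 t (covered M :\: covered N); lia.
  by case/card_gt0P=> x /[!inE] /andP[xt xM]; exists x; rewrite ?inE.
move: xM; rewrite !inE negbK => /andP[/eqP Nx Mx].
set y := M x in Mx.
have My : M y = x by rewrite /y MK.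
have [xA axy] := MA x Mx.
have yx : M y != y by rewrite My eq_sym.
have [yA ayx] := MA y yx; rewrite My in ayx yx; rewrite -/y in axy.
(* If [N] misses [y] as well, adding the edge from [x] to [y] enlarges [N]. *)
have [Ny|Ny] := eqVneq (N y) y.
  pose N' := [ffun w => if w == x then y else if w == y then x else N w].
  have N'm : matching A N'.
    apply/matchingP; split=> w; rewrite !ffunE.
      case: (eqVneq w x) => [->|wx]; first by rewrite eqxx (negbTE Mx).
      case: (eqVneq w y) => [->|wy]; first by rewrite eqxx.
      rewrite NK; case: (eqVneq (N w) x) => [e|_].
        by move: wx; rewrite -(NK w) e Nx eqxx.
      case: (eqVneq (N w) y) => [e|_] //.
      by move: wy; rewrite -(NK w) e Ny eqxx.
    case: (eqVneq w x) => [->//|wx]; case: (eqVneq w y) => [->//|wy]; exact: NA.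
  have := matching_number_max N'm; rewrite -(eqP Ncard).
  apply/negP; rewrite -ltnNge; apply: proper_card; apply/properP; split.
    apply/subsetP => w; rewrite !inE ffunE.
    by case: (eqVneq w x) => [->|_]; [|case: (eqVneq w y) => [->|_]].
  by exists x; rewrite inE ?ffunE ?eqxx ?Nx ?eqxx.
(* Otherwise the edge from [y] to [z] is exchanged for the one from [x] to [y]: the size is the
   same, [t] stays missed, and the agreement with [M] increases. *)
set z := N y in Ny.
have Nz : N z = y by rewrite /z NK.
have zx : z != x by apply/eqP => e; move: Nz Mx; rewrite e Nx => ->; rewrite eqxx.
have ty : t != y by apply/eqP => e; move: Ny; rewrite /z -e Nt eqxx.
have tz : t != z by apply/eqP => e; move: Ny; rewrite -Nz -e Nt eqxx.
pose N' := [ffun w => if w == x then y else if w == y then x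
                      else if w == z then z else N w].
have N'm : matching A N'.
  apply/matchingP; split=> w; rewrite !ffunE.
    case: (eqVneq w x) => [->|wx]; first by rewrite eqxx (negbTE Mx).
    case: (eqVneq w y) => [->|wy]; first by rewrite eqxx.
    case: (eqVneq w z) => [->|wz]; first by rewrite (negbTE zx) (negbTE Ny) eqxx.
    rewrite NK; case: (eqVneq (N w) x) => [e|_].
      by move: wx; rewrite -(NK w) e Nx eqxx.
    case: (eqVneq (N w) y) => [e|_].
      by move: wz; rewrite -(NK w) e eqxx.
    case: (eqVneq (N w) z) => [e|_] //.
    by move: wy; rewrite -(NK w) e Nz eqxx.
  case: (eqVneq w x) => [->//|wx]; case: (eqVneq w y) => [->//|wy].
  by case: (eqVneq w z) => [->|wz]; [rewrite eqxx | exact: NA].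
have cN' : covered N' = x |: (covered N :\ z).
  apply/setP => w; rewrite !inE ffunE.
  case: (eqVneq w x) => [->//|wx] /=; case: (eqVneq w y) => [->|wy] /=.
    by rewrite yx -/z [y == z]eq_sym Ny.
  by case: (eqVneq w z) => [->|wz]; rewrite /= ?eqxx.
have N'max : maximum_matching A N' && (N' t == t).
  rewrite /maximum_matching N'm /= -(eqP Ncard) ffunE [t == x]eq_sym (negbTE xt).
  rewrite (negbTE ty) (negbTE tz) Nt eqxx andbT cN' cardsU1 !inE Nx eqxx andbF /=.
  by rewrite (cardsD1 z (covered N)) inE Nz [y == z]eq_sym Ny.
have := Nbest _ N'max; apply/negP; rewrite -ltnNge.
apply: proper_card; apply/properP; split.
  apply/subsetP => w; rewrite !inE ffunE => /andP[Mw /eqP e].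
  rewrite Mw /=; case: (eqVneq w x) => [->//|wx].
  case: (eqVneq w y) => [->|wy]; first by rewrite My.
  case: (eqVneq w z) => [wz|wz]; last by rewrite e.
  by move: zx; rewrite -wz -My -Nz -wz -e MK eqxx.
exists x; rewrite !inE ?ffunE ?eqxx ?Mx ?Nx //=.
Qed.

(** A member of [P] is a union of components of the graph on [A :\: S], with an odd number of
    vertices in all. *)
Definition odd_barrier A S (P : {set {set T}}) :=
  [/\ S \subset A, trivIset P
    & forall X, X \in P -> [/\ X \subset A :\: S, odd #|X|
        & forall x y, x \in X -> y \in A :\: S -> adj x y -> y \in X]].

(** Induction on the size of [A]. A vertex whose deletion lowers the matching number goes into [S].
    If there is none, every vertex is missed by some maximum matching, and by Gallai's lemma each
    component is odd and contains at most one missed vertex: [S] is empty and [P] is the set of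
    components. *)
Lemma tutte_berge A : exists S P,
  odd_barrier A S P /\ #|S| + (#|A| - matching_number A) <= #|P|.
Proof.
have [n] := ubnP #|A|; elim: n A => // n IHn A.
move=> leA; case: (boolP [exists v in A, matching_number (A :\ v) < matching_number A]).
  case/exists_inP=> v vA lt.
  have [|S [P [[SA tP HP] le]]] := IHn (A :\ v).
    by move: leA; rewrite (cardsD1 v) vA.
  exists (v |: S), P.
  have eAS : A :\: (v |: S) = (A :\ v) :\: S by rewrite setDDl.
  split; first split=> //.
  - by rewrite subUset sub1set vA (subset_trans SA) ?subsetDl.
  - by rewrite eAS.
  have vS : v \notin S by apply/negP => /(subsetP SA); rewrite !inE eqxx.
  have [m /andP[mm /eqP em]] := maximum_matching_exists A.
  have ev := covered_even mm; have := subset_leq_card (covered_sub mm).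
  have [m' /andP[/covered_even ev' /eqP em']] := maximum_matching_exists (A :\ v).
  have cA : #|A| = (#|A :\ v|).+1 by rewrite (cardsD1 v) vA.
  (* Both numbers are even, so the deletion lowers the matching number by at least two, which pays
     for [v] in [S]. *)
  have ne : matching_number A != (matching_number (A :\ v)).+1.
    by apply/eqP => e; move: ev ev'; rewrite em em' e /= => /negPn ->.
  by rewrite cardsU1 vS em cA /= in le *; move: le lt ne; lia.
rewrite negb_exists => /forallP all_missed.
have missed v : v \in A -> exists2 m, maximum_matching A m & m v = v.
  move=> vA; have := all_missed v; rewrite vA /= -leqNgt => le.
  have [m /andP[mm /eqP em]] := maximum_matching_exists (A :\ v).
  have mA := matching_sub (subsetDl A [set v]) mm.
  exists m; first by rewrite /maximum_matching mA eqn_leq matching_number_max // em.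
  apply/eqP; case: (boolP (m v == v)) => // mv.
  have /subsetP/(_ v) := covered_sub mm; by rewrite !inE mv eqxx => /(_ isT).
pose R := [rel x y | [&& x \in A, y \in A & adj x y]].
have R_sym : connect_sym R.
  by apply: sym_connect_sym => x y; rewrite /= andbCA adj_sym.
(* No maximum matching misses two distinct connected vertices. Adjacent ones could be matched to
   each other; along a path, [gallai_transitive] passes from the last vertex but one to the last. *)
have gal x y : x \in A -> connect R x y -> x != y ->
    forall m, maximum_matching A m -> m x = x -> m y != y.
  move=> xA /connectP[p + ->]; elim/last_ind: p => [|p z IHp]; first by rewrite eqxx.
  rewrite rcons_path last_rcons => /andP[px /and3P[tA zA adj_tz]] xz m mM mx.
  have tz m' : maximum_matching A m' -> m' (last x p) = last x p ->
      last x p != z -> m' z != z.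
    move=> m'max m't tz; apply/eqP => m'z.
    have [/matchingP[m'K m'A] /eqP cm'] := andP m'max.
    move: tz m't adj_tz tA; move: (last x p) => t tz m't adj_tz tA.
    pose m2 := [ffun w => if w == t then z else if w == z then t else m' w].
    have m2m : matching A m2.
      apply/matchingP; split=> w; rewrite !ffunE.
        case: (eqVneq w t) => [->|wt]; first by rewrite eqxx eq_sym (negbTE tz).
        case: (eqVneq w z) => [->|wz]; first by rewrite eqxx.
        rewrite m'K; case: (eqVneq (m' w) t) => [e|_].
          by move: wt; rewrite -(m'K w) e m't eqxx.
        case: (eqVneq (m' w) z) => [e|_] //.
        by move: wz; rewrite -(m'K w) e m'z eqxx.
      case: (eqVneq w t) => [->//|wt]; case: (eqVneq w z) => [->|wz]; last exact: m'A.
      by rewrite adj_sym.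
    have := matching_number_max m2m; rewrite -cm'.
    apply/negP; rewrite -ltnNge; apply: proper_card; apply/properP; split.
      apply/subsetP => w; rewrite !inE ffunE.
      case: (eqVneq w t) => [->|_]; first by rewrite m't eqxx.
      by case: (eqVneq w z) => [->|_] //; rewrite m'z eqxx.
    by exists t; rewrite inE ?ffunE ?eqxx ?m't ?eqxx // eq_sym.
  have [ex|xt] := eqVneq x (last x p).
    by apply: tz; rewrite -?ex.
  have [ez|zt] := eqVneq (last x p) z; first by rewrite -ez; apply: IHp.
  apply: (@gallai_transitive A x (last x p) z) => //; first exact: missed.
  - by move=> m' m'max m'x; apply: IHp.
  - by move=> m' m'max m't; apply: tz.
have R_A x y : connect R x y -> x \in A -> y \in A.
  move=> /connectP[p + ->]; elim: p x => // z p IHp x /= /andP[/and3P[_ zA _] pz] _.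
  exact: IHp.
have eqR : {in A & &, equivalence_rel (connect R)}.
  by move=> x y z _ _ _; split=> // xy; apply: same_connect.
have /and3P[/eqP cP tP P0] := equivalence_partitionP eqR.
exists set0, (equivalence_partition (connect R) A).
split; first split=> //; first exact: sub0set.
  move=> X /imsetP[x xA eX]; split.
  - by rewrite setD0; apply/subsetP => y; rewrite eX inE => /andP[].
  - have [m mM mx] := missed x xA; have [/matchingP[mK mA] _] := andP mM.
    have xX : x \in X by rewrite eX inE xA connect0.
    have mX y : y \in X :\ x -> m y != y.
      by rewrite eX !inE => /and3P[yx yA xy]; apply: (gal x y) => //; rewrite eq_sym.
    rewrite (cardsD1 x) xX /= (card_involution_even mK mX) // => y yX.
    have [yA ay] := mA y (mX y yX).
    have yx : m y != x.
      apply/eqP => e; move: yX; rewrite !inE -(mK y) e mx eqxx //.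
    have myA : m y \in A by apply: (mA (m y) _).1; rewrite mK eq_sym mX.
    move: yX; rewrite eX !inE yx myA /= => /and3P[_ _ xy].
    by apply: connect_trans xy _; apply: connect1; rewrite /= yA myA.
  - move=> x' y; rewrite eX setD0 !inE => /andP[x'A xx'] yA axy; rewrite yA /=.
    by apply: connect_trans xx' _; apply: connect1; rewrite /= x'A yA.
rewrite cards0 add0n.
have [m mM] := maximum_matching_exists A.
have [mm /eqP cm] := andP mM.
have -> : #|A| - matching_number A = #|A :\: covered m|.
  by rewrite cardsDS ?covered_sub // cm.
rewrite -(@card_in_imset _ _ (pblock (equivalence_partition (connect R) A))).
  apply: subset_leq_card; apply/subsetP => _ /imsetP[x /[!inE] /andP[_ xA] ->].
  by rewrite pblock_mem // cP.
move=> x y /[!inE]; rewrite !negbK => /andP[/eqP mx xA] /andP[/eqP my yA] e.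
apply/eqP; case: (boolP (x == y)) => // xy.
have : y \in pblock (equivalence_partition (connect R) A) x.
  by rewrite e mem_pblock cP.
rewrite pblock_equivalence_partition // => Rxy.
by have := gal x y xA Rxy xy m mM mx; rewrite my eqxx.
Qed.

End Matchings.

(** * Bridges and blocks *)

Section Ends.
Variable G : mgraph.
Local Notation V := (vertex G).
Local Notation E := (edge G).
Implicit Types (u v w : V) (e : E).

Definition opp_end e v : V := odflt v [pick w in ends e :\ v].

Lemma opp_endP e v : v \in ends e ->
  [/\ opp_end e v != v, opp_end e v \in ends e & ends e = [set v; opp_end e v]].
Proof.
move=> ve; have := card_ends e; rewrite (cardsD1 v) ve => -[/eqP/cards1P[w ew]].
have -> : opp_end e v = w.
  rewrite /opp_end; case: pickP => [w'|/(_ w)] /=; last by rewrite ew set11.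
  by rewrite ew inE => /eqP.
have : w \in ends e :\ v by rewrite ew set11.
by rewrite !inE => /andP[wv we]; split=> //; rewrite -ew setD1K.
Qed.

Lemma opp_neq e v : v \in ends e -> opp_end e v != v.
Proof. by case/opp_endP. Qed.

Lemma opp_in e v : v \in ends e -> opp_end e v \in ends e.
Proof. by case/opp_endP. Qed.

Lemma ends_cases e v w : v \in ends e -> w \in ends e -> w = v \/ w = opp_end e v.
Proof. by case/opp_endP=> _ _ ->; rewrite !inE => /orP[]/eqP; [left|right]. Qed.

Lemma oppK e v : v \in ends e -> opp_end e (opp_end e v) = v.
Proof.
move=> ve; have oe := opp_in ve.
case: (ends_cases oe ve) => // e1.
by have := opp_neq ve; rewrite -e1 eqxx.
Qed.

Lemma end_exists e : exists v, v \in ends e.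
Proof. by apply/card_gt0P; rewrite card_ends. Qed.

(** Reversal of a dart, a vertex with an incident edge. Other pairs are left alone, which makes this
    an involution of the whole type. *)
Definition flip (d : V * E) : V * E :=
  if d.1 \in ends d.2 then (opp_end d.2 d.1, d.2) else d.

Lemma flipK : involutive flip.
Proof.
move=> [v e]; rewrite /flip /=; case: (boolP (v \in ends e)) => [ve|/negbTE ve] /=.
  by rewrite opp_in // oppK.
by rewrite ve.
Qed.

Definition crosses (s : V -> bool) e :=
  [exists v in ends e, s v != s (opp_end e v)].

Lemma crossesE s e v : v \in ends e -> crosses s e = (s v != s (opp_end e v)).
Proof.
move=> ve; apply/exists_inP/idP => [[w we]|]; last by exists v.
by case: (ends_cases ve we) => ->; rewrite // oppK // eq_sym.
Qed.

(* Bridges are defined by cuts instead of connectivity, because cuts can be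
   added modulo 2. *)
Definition bridge e :=
  [exists s : {ffun V -> bool}, [forall e', crosses s e' == (e' == e)]].

Definition cut e : V -> bool :=
  if [pick s : {ffun V -> bool} | [forall e', crosses s e' == (e' == e)]] is Some s
  then s else fun=> false.

Lemma cutP e e' v : bridge e -> v \in ends e' ->
  cut e v (+) cut e (opp_end e' v) = (e' == e).
Proof.
rewrite /bridge /cut => be ve; case: pickP => [s /forallP/(_ e')/eqP|no].
  by rewrite (crossesE _ ve) -negb_eqb.
by case/existsP: be => s; rewrite no.
Qed.

Lemma bridgeI e (s : V -> bool) :
  (forall e' v, v \in ends e' -> s v (+) s (opp_end e' v) = (e' == e)) -> bridge e.
Proof.
move=> sP; apply/existsP; exists [ffun v => s v]; apply/forallP => e'.
have [v ve] := end_exists e'.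
by rewrite (crossesE _ ve) !ffunE negb_eqb sP.
Qed.

(** The sum modulo 2 of the cuts of the bridges marked by [dm]. It serves to reverse everything on
    one side of a bridge, and to remove bridges from a given cut. *)
Lemma bridge_gluing (dm : E -> bool) : exists t : V -> bool, forall e v,
  v \in ends e -> t v (+) t (opp_end e v) = bridge e && dm e.
Proof.
exists (fun v => \big[addb/false]_(e | bridge e && dm e) cut e v) => e v ve.
rewrite -big_split /=.
rewrite (eq_bigr (fun e' => e == e')); last by move=> e' /andP[be' _]; apply: cutP.
rewrite big_mkcond (bigD1 e) //= big1 ?addbF => [|e' /negbTE ne].
  by rewrite eqxx; case: ifP.
by rewrite eq_sym ne; case: ifP.
Qed.

Definition adjacent : rel V :=
  [rel u v | [exists e, (u \in ends e) && (v == opp_end e u)]].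

Definition nb_adjacent : rel V :=
  [rel u v | [exists e, [&& ~~ bridge e, u \in ends e & v == opp_end e u]]].

(** Blocks are the components left when all bridges are deleted, that is, the 2-edge-connected
    components. *)
Definition same_block := connect nb_adjacent.

Definition base v := fingraph.root adjacent v.

(* [far_side e] is the side of the bridge [e] away from the root of its
   component. *)
Definition far_side e v := cut e v != cut e (base v).

Definition top v e := [&& bridge e, v \in ends e & far_side e v].

Lemma adjacent_sym : connect_sym adjacent.
Proof.
apply: sym_connect_sym => u v; apply/existsP/existsP => -[e /andP[ue /eqP->]];
  by exists e; rewrite opp_in // oppK // eqxx.
Qed.

Lemma nb_adjacent_sym : connect_sym nb_adjacent.
Proof.
apply: sym_connect_sym => u v; apply/existsP/existsP => -[e /and3P[be ue /eqP->]];
  by exists e; rewrite be opp_in // oppK // eqxx.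
Qed.

Lemma same_block_refl v : same_block v v.
Proof. exact: connect0. Qed.

Lemma same_block_sym : symmetric same_block.
Proof. exact: nb_adjacent_sym. Qed.

Lemma same_block_trans : transitive same_block.
Proof. by move=> v u w; apply: connect_trans. Qed.

Lemma base_opp e v : v \in ends e -> base (opp_end e v) = base v.
Proof.
move=> ve; apply/eqP; rewrite root_connect; last exact: adjacent_sym.
by rewrite adjacent_sym; apply: connect1; apply/existsP; exists e; rewrite ve eqxx.
Qed.

Lemma same_block_opp e v : ~~ bridge e -> v \in ends e -> same_block v (opp_end e v).
Proof. by move=> be ve; apply: connect1; apply/existsP; exists e; rewrite be ve eqxx. Qed.

Lemma far_side_opp e e' v : bridge e -> v \in ends e' ->
  far_side e v (+) far_side e (opp_end e' v) = (e' == e).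
Proof.
move=> be ve; rewrite -(cutP be ve) /far_side base_opp // !negb_eqb.
by case: (cut e v); case: (cut e _); case: (cut e _).
Qed.

Lemma far_side_block e v w : bridge e -> same_block v w -> far_side e v = far_side e w.
Proof.
move=> be /connectP[p + ->]; elim: p v => // w' p IHp v /= /andP[+ pp].
case/existsP=> e' /and3P[be' ve' /eqP ew']; rewrite -(IHp w' pp) ew'.
have := far_side_opp be ve'.
have -> : (e' == e) = false by apply/negbTE; apply: contraNneq be' => ->.
by case: (far_side e v); case: (far_side e _).
Qed.

Lemma top_opp e v : bridge e -> v \in ends e -> top (opp_end e v) e = ~~ top v e.
Proof.
move=> be ve; rewrite /top be ve opp_in //=.
by have := far_side_opp be ve; rewrite eqxx; case: (far_side e v); case: (far_side e _).
Qed.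

(** If [e] and [e'] differed, no step could leave the set [out] of vertices on the near side of
    both: crossing [e] leads to [v], which is beyond [e'] too, and symmetrically. But [out] contains
    the root of the component and not [v]. *)
Lemma top_block e e' v v' : top v e -> top v' e' -> same_block v v' -> e = e'.
Proof.
move=> /and3P[be ve ev] /and3P[be' ve' ev'] vv'; apply/eqP/negPn/negP => ee'.
have e'v : far_side e' v by rewrite (far_side_block be' vv').
have ev'' : far_side e v' by rewrite -(far_side_block be vv').
pose out z := ~~ far_side e z && ~~ far_side e' z.
have cl z w : adjacent z w -> out z -> out w.
  case/existsP=> f /andP[zf /eqP->] /andP[ez e'z].
  have := far_side_opp be zf; have := far_side_opp be' zf.
  rewrite (negbTE ez) (negbTE e'z) !addFb /out => o' o.
  apply/andP; split; apply/negP => far.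
    move: o; rewrite far => /esym/eqP ff; subst f.
    case: (ends_cases zf ve) => e1; first by move: ez; rewrite -e1 ev.
    by move: o'; rewrite -e1 e'v => /esym; rewrite (negbTE ee').
  move: o'; rewrite far => /esym/eqP ff; subst f.
  case: (ends_cases zf ve') => e1; first by move: e'z; rewrite -e1 ev'.
  by move: o; rewrite -e1 ev'' => /esym; rewrite eq_sym (negbTE ee').
have out_con z w : connect adjacent z w -> out z -> out w.
  by move/connectP=> [p + ->]; elim: p z => // y p IHp z /= /andP[/cl zy pp] /zy; apply: IHp.
have bb : base (base v) = base v by apply: root_root; exact: adjacent_sym.
have : out v.
  apply: (out_con (base v)); first by rewrite adjacent_sym connect_root.
  by rewrite /out /far_side bb !eqxx.
by rewrite /out ev.
Qed.

End Ends.

Section Cubic.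
Variable G : mgraph.
Hypothesis cubicG : cubic G.
Local Notation V := (vertex G).
Local Notation E := (edge G).
Implicit Types (u v w : V) (e : E).

Lemma third_edge v e1 e2 : v \in ends e1 -> v \in ends e2 -> e1 != e2 ->
  exists e3, [/\ v \in ends e3, e3 != e1, e3 != e2
               & forall e, v \in ends e -> [\/ e = e1, e = e2 | e = e3]].
Proof.
move=> ve1 ve2 ne; have := cubicG v; rewrite /degree.
rewrite (cardsD1 e1) inE ve1 (cardsD1 e2) !inE ve2 eq_sym ne => -[/eqP/cards1P[e3 e3P]].
have : e3 \in [set e3] by rewrite set11.
rewrite -e3P !inE => /and3P[n2 n1 ve3]; exists e3; split=> // e ve.
have [->|e1n] := eqVneq e e1; first by constructor 1.
have [->|e2n] := eqVneq e e2; first by constructor 2.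
by constructor 3; apply/eqP; rewrite -in_set1 -e3P !inE e1n e2n ve.
Qed.

(** Modulo 2, the cuts of [e1] and [e2] and the star of [v] add up to a cut crossed by the third
    edge alone. *)
Lemma bridges_at v e1 e2 e : bridge e1 -> bridge e2 -> e1 != e2 ->
  v \in ends e1 -> v \in ends e2 -> v \in ends e -> bridge e.
Proof.
move=> b1 b2 ne v1 v2 ve.
have [e3 [v3 n31 n32 only]] := third_edge v1 v2 ne.
case: (only e ve) => -> //.
apply: (@bridgeI _ _ (fun w => cut e1 w (+) cut e2 w (+) (w == v))) => e' w we'.
have E4 (a b c a' b' c' : bool) :
    a (+) b (+) c (+) (a' (+) b' (+) c') = (a (+) a') (+) (b (+) b') (+) (c (+) c').
  by case: a; case: b; case: c; case: a'; case: b'; case: c'.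
rewrite E4 (cutP b1 we') (cutP b2 we').
have -> : (w == v) (+) (opp_end e' w == v) = (v \in ends e').
  have [_ _ ->] := opp_endP we'; rewrite !inE ![v == _]eq_sym.
  by case: (eqVneq w v) (opp_neq we') => [->|_ _] //= /negbTE->.
case: (boolP (v \in ends e')) => [/only[]->|ve']; rewrite ?eqxx.
- by rewrite (negbTE ne) eq_sym (negbTE n31).
- by rewrite eq_sym (negbTE ne) eq_sym (negbTE n32).
- by rewrite (negbTE n31) (negbTE n32).
have out f : v \in ends f -> (e' == f) = false.
  by move=> vf; apply/negbTE; apply: contraNneq ve' => ->.
by rewrite !out.
Qed.

End Cubic.

(** * Disjoint cycles avoiding the bridges *)

Section CycleCover.
Variable G : mgraph.
Hypothesis cubicG : cubic G.
Local Notation V := (vertex G).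
Local Notation E := (edge G).
Implicit Types (u v w : V) (e : E).

Definition nb_edges v : {set E} := [set e | (v \in ends e) && ~~ bridge e].
Definition is_top v := [exists e, top v e].

Lemma card_nb_edges v e : e \in nb_edges v -> #|nb_edges v| = 2 \/ #|nb_edges v| = 3.
Proof.
rewrite inE => /andP[ve be].
have c3 := cubicG v; rewrite /degree in c3.
have sub : nb_edges v = [set f | v \in ends f] :\: [set f in [set f | v \in ends f] | bridge f].
  by apply/setP => f; rewrite !inE; case: (v \in _); case: (bridge f).
have -> : #|nb_edges v| = 3 - #|[set f in [set f | v \in ends f] | bridge f]|.
  rewrite sub cardsDS ?c3 //; by apply/subsetP => f; rewrite !inE => /andP[].
have : #|[set f in [set f | v \in ends f] | bridge f]| < 2.
  rewrite ltnNge; apply: contra be => /card_gt1P[f [g []]].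
  by rewrite !inE => /andP[vf bf] /andP[vg bg] fg; apply: (bridges_at cubicG bf bg fg vf vg).
by case: #|_| => [|[|]] //; [right | left].
Qed.

Local Notation node := (V + V * E)%type.

(* Perfect matchings of the following graph are the complements of the desired
   families of cycles: a vertex with a single incident bridge is split in two
   adjacent halves, one for each of its other edges, unless it is a top, in
   which case it is removed. *)
Definition node_of (d : V * E) : node :=
  if #|nb_edges d.1| == 3 then inl d.1 else inr d.

Definition node_vertex (h : node) : V :=
  match h with inl v => v | inr d => d.1 end.

(** For a half, the other half of the same vertex, carrying the other non-bridge. *)
Definition mate (h : node) : node :=
  match h with
  | inl v => inl v
  | inr (v, e) => inr (v, odflt e [pick f in nb_edges v :\ e])
  end.

Definition split_node (h : node) := if h is inr _ then true else false.

Definition valid_node (h : node) :=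
  match h with
  | inl v => #|nb_edges v| == 3
  | inr (v, e) => [&& #|nb_edges v| == 2, e \in nb_edges v & ~~ is_top v]
  end.

Definition linked e (h h' : node) :=
  ~~ bridge e && [exists v in ends e,
    (h == node_of (v, e)) && (h' == node_of (opp_end e v, e))].

Definition node_adj : rel node :=
  [rel h h' | [exists e, linked e h h']
    || [&& split_node h, valid_node h & h' == mate h]].

Definition block_nodes k : {set node} :=
  [set h | same_block k (node_vertex h) && valid_node h].

Lemma linked_sym e h h' : linked e h h' = linked e h' h.
Proof.
rewrite /linked; congr (_ && _); apply/exists_inP/exists_inP => -[v ve /andP[hv hv']];
  by exists (opp_end e v); rewrite ?opp_in // oppK // hv hv'.
Qed.

Lemma mateP v e : #|nb_edges v| = 2 -> e \in nb_edges v ->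
  exists f, [/\ mate (inr (v, e)) = inr (v, f), f \in nb_edges v, f != e,
    mate (inr (v, f)) = inr (v, e) & forall g, g \in nb_edges v -> g = e \/ g = f].
Proof.
move=> c2 en; move: c2; rewrite (cardsD1 e) en => -[/eqP/cards1P[f ef]].
have : f \in nb_edges v :\ e by rewrite ef set11.
rewrite in_setD1 => /andP[fe fn].
have only g : g \in nb_edges v -> g = e \/ g = f.
  move=> gn; have [->|ge] := eqVneq g e; [by left|right].
  by apply/eqP; rewrite -in_set1 -ef in_setD1 ge.
exists f; split=> //=; congr (inr (_, _)).
  case: pickP => [g|/(_ f)] /=; last by rewrite in_setD1 fe fn.
  by rewrite in_setD1 => /andP[ge /only[]// e1]; move: ge; rewrite e1 eqxx.
case: pickP => [g|/(_ e)] /=; last by rewrite in_setD1 eq_sym fe en.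
by rewrite in_setD1 => /andP[ge /only[]// e1]; move: ge; rewrite e1 eqxx.
Qed.

Lemma mate_valid h : valid_node h -> split_node h ->
  [/\ valid_node (mate h), split_node (mate h), mate (mate h) = h,
      mate h != h & node_vertex (mate h) = node_vertex h].
Proof.
case: h => [//|[v e]] /and3P[/eqP c2 en ntop] _.
have [f [-> fn fe mf _]] := mateP c2 en.
split=> //=; first by rewrite c2 fn ntop.
by rewrite (inj_eq inr_inj) xpair_eqE eqxx.
Qed.

Lemma node_adj_sym : symmetric node_adj.
Proof.
suff imp h h' : node_adj h h' -> node_adj h' h by move=> h h'; apply/idP/idP; apply: imp.
case/orP=> [/existsP[e le]|/and3P[sh vh /eqP->]]; apply/orP.
  by left; apply/existsP; exists e; rewrite linked_sym.
right; have [-> -> -> _ _] := mate_valid vh sh; exact: eqxx.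
Qed.

Definition nb_darts : {set V * E} := [set d | d.2 \in nb_edges d.1].
Definition fiber h := [set d in nb_darts | node_of d == h].

Lemma card_fiber h : valid_node h -> #|fiber h| = if split_node h then 1 else 3.
Proof.
case: h => [v /eqP c3|[v e] /and3P[/eqP c2 en _]] /=.
  rewrite -c3 -(card_imset _ (_ : injective (pair v))); last by move=> x y [].
  congr #|pred_of_set _|; apply/setP => -[w f]; rewrite !inE /node_of /=.
  apply/andP/imsetP => [[wf]|[g]].
    by case: ifP => // _ /eqP[e1]; subst w; exists f; rewrite // !inE.
  by rewrite inE => gn [-> ->]; rewrite gn c3 eqxx.
rewrite -(cards1 (v, e)); congr #|pred_of_set _|; apply/setP => -[w f].
rewrite in_set [_ \in nb_darts]in_set in_set1 /node_of /=.
apply/andP/eqP => [[_]|[-> ->]].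
  by case: ifP => // _ /eqP[-> ->].
by rewrite en c2 /= eqxx.
Qed.

Lemma flip_nb d : d \in nb_darts -> flip d \in nb_darts.
Proof.
case: d => v e; rewrite !inE /flip /= => /andP[ve be].
by rewrite ve /= opp_in.
Qed.

Lemma flip_linked d : d \in nb_darts -> linked d.2 (node_of d) (node_of (flip d)).
Proof.
case: d => v e; rewrite !inE /flip /= => /andP[ve be]; rewrite ve /linked be.
by apply/existsP; exists v; rewrite ve !eqxx.
Qed.

(** * Counting edges between an odd barrier and its parts *)

Section Barrier.
Variables (k : V) (S : {set node}) (P : {set {set node}}).
Hypothesis barrier : odd_barrier node_adj (block_nodes k) S P.

Local Notation A := (block_nodes k).

Definition blocked h := h \notin A :\: S.
Definition exits h := [set d in fiber h | blocked (node_of (flip d))].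
Definition torn h := split_node h && (mate h \in S).
(** Counting the link to a mate in [S] twice gives each node of [S] the capacity three: three edges,
    or one edge and a mate. *)
Definition weight h := #|exits h| + (torn h).*2.

Lemma sum_fibers (X : {set node}) (B : pred (V * E)) :
  \sum_(h in X) #|[set d in fiber h | B d]| =
  #|[set d in nb_darts | (node_of d \in X) && B d]|.
Proof.
rewrite -sum1_card (partition_big node_of (mem X)) /=; last first.
  by move=> d /[!inE] /and3P[].
apply: eq_bigr => h hX; rewrite -sum1_card; apply: eq_bigl => d.
rewrite !inE; case: (d.1 \in _) => //=; case: (~~ _) => //=.
by case: (eqVneq (node_of d) h) => [->|_]; rewrite ?hX ?andbT ?andbF.
Qed.

(** All fibers and all parts are odd, so the number of darts leaving [X] is odd. Were it one, with
    no mates torn apart, [X] would come from whole vertices and have a single outgoing non-bridge,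
    which would then be a bridge. *)
Lemma part_weight X : X \in P -> 2 < \sum_(h in X) weight h.
Proof.
have [SA _ HP] := barrier => /HP[/subsetP XAS oddX closedX].
have XA h : h \in X -> h \in A by move/XAS; rewrite in_setD => /andP[].
have Xv h : h \in X -> valid_node h by move/XA; rewrite inE => /andP[].
rewrite /weight big_split /= sum_fibers.
pose XD := [set d in nb_darts | node_of d \in X].
pose C := [set d in nb_darts | (node_of d \in X) && blocked (node_of (flip d))].
rewrite -/C.
have step d : d \in nb_darts -> node_of d \in X -> ~~ blocked (node_of (flip d)) ->
    node_of (flip d) \in X.
  move=> dn dX; rewrite negbK => fA; apply: (closedX _ _ dX fA).
  by apply/orP; left; apply/existsP; exists d.2; apply: flip_linked.
have notX h : blocked h -> h \notin X by apply: contra => /XAS.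
have oddXD : odd #|XD|.
  have -> : #|XD| = \sum_(h in X) #|fiber h|.
    have := sum_fibers X xpredT => e.
    rewrite (eq_bigr (fun h => #|[set d in fiber h | true]|)).
      by rewrite e; congr #|pred_of_set _|; apply/setP => d; rewrite !inE andbT.
    by move=> h _; congr #|pred_of_set _|; apply/setP => d; rewrite !inE andbT.
  have : odd (\sum_(h in X) 1) by rewrite sum1_card.
  rewrite !(big_morph odd oddD (erefl (odd 0))); congr is_true.
  by apply: eq_bigr => h /Xv vh; rewrite card_fiber //; case: (split_node h).
have CXD : C \subset XD by apply/subsetP => d; rewrite !inE => /and3P[-> ->].
have oddC : odd #|C|.
  (* Edges inside [X] contribute both of their darts. *)
  have ev : ~~ odd #|XD :\: C|.
    have inXC d : d \in XD :\: C ->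
        [/\ d \in nb_darts, node_of d \in X & ~~ blocked (node_of (flip d))].
      rewrite in_setD [d \in C]in_set [d \in XD]in_set => /andP[+ /andP[dn dX]].
      by rewrite dn dX.
    apply: (card_involution_even (@flipK G)) => d /inXC[dn dX nb].
      move: dn; case: d {dX nb} => v e; rewrite !inE /flip /= => /andP[ve _].
      by rewrite ve xpair_eqE negb_and opp_neq.
    rewrite in_setD [_ \in C]in_set [_ \in XD]in_set flip_nb // step //= andbT.
    by rewrite flipK negbK XAS.
  have := cardsID C XD; rewrite (setIidPr CXD) => e.
  by move: oddXD; rewrite -e oddD (negbTE ev) addbF.
have [gt|le] := ltnP 1 #|C|.
  by move: oddC gt; case: #|C| => [|[|[|]]] // n _ _; rewrite addSn.
have {}le : #|C| = 1 by move: oddC le; case: #|C| => [|[|]].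
have [/existsP[h /andP[hX th]]|/existsPn notorn] := boolP [exists h, (h \in X) && torn h].
  by rewrite le (bigD1 h) //= th.
have mateX h : h \in X -> split_node h -> mate h \in X.
  move=> hX sh; have [vm _ _ _ em] := mate_valid (Xv h hX) sh.
  apply: (closedX h (mate h) hX).
    have := notorn h; rewrite hX /torn sh /= in_setD => ->.
    by move: (XA h hX); rewrite !inE em vm => /andP[->].
  by apply/orP; right; rewrite sh Xv ?eqxx.
have /cards1P[[v0 e0] eC] : #|C| == 1 by rewrite le.
pose s v := [exists e in nb_edges v, node_of (v, e) \in X].
have sE v e : e \in nb_edges v -> s v = (node_of (v, e) \in X).
  move=> en; apply/exists_inP/idP => [[f fn]|]; last by exists e.
  rewrite /node_of /=; case: ifP => // c3 fX.
  have c2 : #|nb_edges v| = 2 by case: (card_nb_edges en) c3 => ->.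
  have [f' [ef _ _ _ only]] := mateP c2 fn.
  case: (only e en) => -> //; rewrite -ef; exact: mateX.
have : (v0, e0) \in C by rewrite eC set11.
rewrite in_set => /and3P[]; rewrite inE /= => e0n v0X v0b.
have nbe0 : ~~ bridge e0 by move: e0n; rewrite inE => /andP[].
(* Besides [e0], only bridges cross [s]; adding their cuts leaves a cut crossed by [e0] alone. *)
have [t tP] := bridge_gluing (crosses s).
exfalso; apply: (negP nbe0); apply: (@bridgeI _ _ (fun v => s v (+) t v)) => e v ve.
rewrite addbACA tP // (crossesE _ ve).
case: (boolP (bridge e)) => [be|be] /=.
  have -> : (e == e0) = false by apply/negbTE; apply: contraNneq nbe0 => <-.
  by case: (s v); case: (s _).
have en w : w \in ends e -> e \in nb_edges w by rewrite inE be andbT.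
have CE w : w \in ends e -> s w && ~~ s (opp_end e w) = ((w, e) == (v0, e0)).
  move=> we; rewrite -in_set1 -eC in_set in_set /= en //= (sE _ _ (en w we)).
  rewrite (sE _ _ (en _ (opp_in we))); case wX: (node_of (w, e) \in X) => //=.
  have eflip : flip (w, e) = (opp_end e w, e) by rewrite /flip /= we.
  rewrite eflip; apply/idP/idP => [|/notX//].
  by apply: contraR => nb; rewrite -eflip step ?eflip // in_set /= en.
have := CE v ve; have := CE _ (opp_in ve); rewrite oppK // !xpair_eqE addbF.
case: (eqVneq e e0) => [ee|_]; last by rewrite !andbF; case: (s v); case: (s _).
subst e; rewrite !andbT.
have v0e : v0 \in ends e0 by move: e0n; rewrite inE => /andP[].
case: (ends_cases ve v0e) => ->; rewrite eqxx;
  by case: (s v) => //=; case: (s _) => //=.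
Qed.

(** Each part weighs at least 3 and each node of [S] absorbs 3. The only other places where a dart
    can leave a part are at the removed top of the block, which has two non-bridges. So 3 * #|P| <=
    3 * #|S| + 2, and the claim follows by integrality. *)
Lemma barrier_small : #|P| <= #|S|.
Proof.
have [/subsetP SA tP HP] := barrier.
have covA h : h \in cover P -> h \in A :\: S.
  by case/bigcupP=> X /HP[/subsetP XAS _ _] /XAS.
have lower : 3 * #|P| <= \sum_(h in cover P) weight h.
  rewrite big_trivIset //= mulnC -sum_nat_const; apply: leq_sum => X; exact: part_weight.
suff upper : \sum_(h in cover P) weight h <= 3 * #|S| + 2 by lia.
rewrite /weight big_split /= sum_fibers.
set Cr := [set d in _ | _].
pose T := [set d in nb_darts | is_top d.1 && same_block k d.1 && (#|nb_edges d.1| == 2)].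
have T2 : #|T| <= 2.
  case: (set_0Vmem T) => [->|[[x f]]]; first by rewrite cards0.
  rewrite !inE /= => /and3P[_ /andP[/existsP[g tg] kx] /eqP c2].
  rewrite -c2 -(card_imset _ (_ : injective (pair x))); last by move=> a b [].
  apply: subset_leq_card; apply/subsetP => -[y f'].
  rewrite !inE /= => /and3P[yf /andP[/existsP[g' tg'] ky] _].
  have eg : g = g'.
    apply: top_block tg tg' _; apply: connect_trans ky.
    by rewrite nb_adjacent_sym.
  subst g'; have eyx : y = x.
    have /and3P[bg xg _] := tg; have /and3P[_ yg _] := tg'.
    case: (ends_cases xg yg) => // ey.
    by move: tg'; rewrite ey top_opp // tg.
  by subst y; apply: imset_f; rewrite inE.
have leCr : #|Cr| <= \sum_(h in S) #|fiber h| + 2.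
  rewrite -(card_imset _ (inv_inj (@flipK G))).
  have -> : \sum_(h in S) #|fiber h| = #|[set d in nb_darts | node_of d \in S]|.
    rewrite (eq_bigr (fun h => #|[set d in fiber h | true]|)).
      by rewrite sum_fibers; congr #|pred_of_set _|; apply/setP => d; rewrite !inE andbT.
    by move=> h _; congr #|pred_of_set _|; apply/setP => d; rewrite !inE andbT.
  rewrite (leq_trans _ (leq_add (leqnn _) T2)) // (leq_trans _ (leq_card_setU _ _)) //.
  apply: subset_leq_card; apply/subsetP => _ /imsetP[d + ->].
  rewrite in_set => /and3P[dn /covA dA fb].
  have fn := flip_nb dn; rewrite in_setU.
  rewrite [_ \in [set d in nb_darts | node_of d \in S]]in_set [_ \in T]in_set fn /=.
  move: fb; rewrite /blocked in_setD negb_and negbK.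
  case: (node_of (flip d) \in S) => //= fA.
  have kf : same_block k (flip d).1.
    move: dA; rewrite in_setD in_set => /and3P[_ kd _].
    have -> : (flip d).1 = opp_end d.2 d.1.
      by move: dn; rewrite !inE /flip => /andP[-> _].
    apply: connect_trans (_ : same_block d.1 _).
      by move: kd; rewrite /node_of; case: ifP.
    by move: dn; rewrite !inE => /andP[??]; apply: same_block_opp.
  move: fA fn; case: (flip d) kf => x f /= kx; rewrite [_ \in nb_darts]in_set /= => + fn.
  rewrite in_set /node_of /=; case: (card_nb_edges fn) => c2.
    by rewrite c2 /= kx c2 fn /= andbT negbK andbT.
  by rewrite c2 /= kx c2.
have leT : \sum_(h in cover P) (torn h).*2 <= \sum_(h in S) (split_node h).*2.
  have sumE (X : {set node}) (b : pred node) :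
      \sum_(h in X) (b h).*2 = #|[set h in X | b h]|.*2.
    rewrite -sum1_card (big_morph double doubleD (erefl 0.*2)).
    rewrite [LHS]big_mkcond [RHS]big_mkcond /=; apply: eq_bigr => h _.
    by rewrite inE; case: (h \in X); case: (b h).
  rewrite !sumE leq_double.
  have val h : h \in [set h in cover P | torn h] ->
      [/\ valid_node h, split_node h & mate h \in S].
    rewrite in_set => /andP[/covA + /andP[sh mS]].
    by rewrite in_setD in_set => /and3P[_ _ ->].
  rewrite -(@card_in_imset _ _ mate) => [|h h' /val[vh sh _] /val[vh' sh' _] e].
    apply: subset_leq_card; apply/subsetP => _ /imsetP[h /val[vh sh mS] ->].
    by rewrite in_set mS; have [_ ->] := mate_valid vh sh.
  have [_ _ <- _ _] := mate_valid vh sh; rewrite e.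
  by have [_ _ -> _ _] := mate_valid vh' sh'.
have three : \sum_(h in S) #|fiber h| + \sum_(h in S) (split_node h).*2 = 3 * #|S|.
  rewrite -big_split /= mulnC -sum_nat_const; apply: eq_bigr => h hS.
  rewrite card_fiber; first by case: (split_node h).
  by move: (SA h hS); rewrite inE => /andP[].
by rewrite -three addnAC leq_add.
Qed.

End Barrier.

(** * Perfect matchings of the nodes and the cycles they leave *)

Lemma block_matching k : exists m : {ffun node -> node},
  matching node_adj (block_nodes k) m /\ covered m = block_nodes k.
Proof.
have [S [P [bar le]]] := tutte_berge node_adj_sym (block_nodes k).
have small := barrier_small bar.
have [m /andP[mm /eqP cm]] := maximum_matching_exists node_adj (block_nodes k).
exists m; split=> //; apply/eqP; rewrite eqEcard (covered_sub mm) cm.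
by rewrite -subn_eq0 -leqn0 -(leq_add2l #|S|) addn0 (leq_trans le small).
Qed.

(** [F] consists of the non-bridges that the union [m] of the perfect matchings does not use. A full
    node loses one of its three edges. Two halves matched to each other lose none, nor does a
    removed top. Otherwise both halves lose their edges, and the vertex lies off the cycles. *)
Theorem cycle_cover : exists F : {set E},
  (forall e, e \in F -> ~~ bridge e) /\
  forall v, #|[set e in F | v \in ends e]| = 2 \/
    [/\ #|[set e in F | v \in ends e]| = 0, #|nb_edges v| <> 3
      & forall e, top v e -> nb_edges v = set0].
Proof.
have [mk mkP] := fin_all_exists block_matching.
pose blk v := fingraph.root (@nb_adjacent G) v.
pose m h := mk (blk (node_vertex h)) h.
have blk_same v w : same_block v w -> blk v = blk w.
  by move=> vw; apply/eqP; rewrite root_connect //; exact: nb_adjacent_sym.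
have blk_con v : same_block (blk v) v by rewrite /same_block nb_adjacent_sym connect_root.
have blkK v : blk (blk v) = blk v by apply: root_root; exact: nb_adjacent_sym.
have mblk h : node_vertex (m h) = node_vertex h \/ same_block (node_vertex h) (node_vertex (m h)).
  rewrite /m; set k := blk _; have [/matchingP[mK mA] cm] := mkP k.
  have [->|ne] := eqVneq (mk k h) h; [by left|right].
  have [hA _] := mA h ne; have hA' : mk k h \in block_nodes k.
    by rewrite -cm inE mK eq_sym.
  move: hA hA'; rewrite !inE => /andP[kh _] /andP[kh' _].
  by apply: connect_trans kh'; rewrite nb_adjacent_sym.
have blkm h : blk (node_vertex (m h)) = blk (node_vertex h).
  by case: (mblk h) => [->//|/blk_same->].
have mK : involutive m.
  move=> h; rewrite {1}/m blkm /m; have [/matchingP[+ _] _] := mkP (blk (node_vertex h)).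
  exact.
have madj h : valid_node h -> m h != h /\ node_adj h (m h).
  move=> vh; rewrite /m; have [/matchingP[_ mA] cm] := mkP (blk (node_vertex h)).
  have : h \in covered (mk (blk (node_vertex h))) by rewrite cm inE vh blk_con.
  by rewrite inE => ne; split=> //; case: (mA h ne).
have minv h : ~~ valid_node h -> m h = h.
  move=> vh; rewrite /m; have [_ cm] := mkP (blk (node_vertex h)).
  apply/eqP/negPn/negP => ne.
  have : h \in covered (mk (blk (node_vertex h))) by rewrite inE.
  by rewrite cm inE (negbTE vh) andbF.
(* Both nodes of a matched pair select the same edge among parallel ones. *)
pose sel h := [pick e | linked e h (m h)].
pose M := [set e | [exists v in ends e, sel (node_of (v, e)) == Some e]].
have selm h : sel (m h) = sel h.
  by apply: eq_pick => e; rewrite mK linked_sym.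
have nv d : node_vertex (node_of d) = d.1 by rewrite /node_of; case: ifP.
have linkedP v e h : linked e (node_of (v, e)) h ->
    [/\ ~~ bridge e, v \in ends e & h = node_of (opp_end e v, e)].
  case/andP=> be /exists_inP[u ue /andP[/eqP euv /eqP ->]].
  have : node_vertex (node_of (v, e)) = node_vertex (node_of (u, e)) by rewrite euv.
  by rewrite !nv /= => ->.
have selP h e : sel h = Some e -> linked e h (m h).
  by rewrite /sel; case: pickP => // e' le [<-].
have ME v e : v \in ends e -> (e \in M) = (sel (node_of (v, e)) == Some e).
  move=> ve; rewrite inE; apply/exists_inP/idP => [[u ue /eqP se]|]; last by exists v.
  case: (ends_cases ue ve) => ->; first by rewrite se.
  by have [_ _ <-] := linkedP _ _ _ (selP _ _ se); rewrite selm se.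
have sel_mate v e : sel (node_of (v, e)) = Some e ->
    node_vertex (m (node_of (v, e))) != v.
  by move=> /selP/linkedP[_ ve ->]; rewrite nv /= opp_neq.
pose F := [set e | ~~ bridge e && (e \notin M)].
have FE v : [set e in F | v \in ends e] =
    [set e in nb_edges v | sel (node_of (v, e)) != Some e].
  apply/setP => e; rewrite !inE; case: (boolP (v \in ends e)) => ve; last by rewrite andbF.
  by move: (ME v e ve); rewrite inE andbT => ->.
have linked_vertex v e h h' : node_vertex h = v -> linked e h h' ->
    h = node_of (v, e) /\ e \in nb_edges v.
  move=> hv /andP[be /exists_inP[u ue /andP[/eqP eh _]]].
  by move: hv; rewrite eh nv /= => euv; subst u; rewrite inE ue be.
exists F; split=> [e|v]; first by rewrite inE => /andP[].
rewrite FE; have [->|[e en]] := set_0Vmem (nb_edges v).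
  right; split=> //; last by rewrite cards0.
  by apply/eqP; rewrite cards_eq0; apply/eqP/setP => e; rewrite !inE.
case: (card_nb_edges en) => c; last first.
  left; have nodeE f : node_of (v, f) = inl v by rewrite /node_of /= c.
  have [_ /orP[/existsP[f lf]|/andP[]//]] := madj (inl v) (introT eqP c).
  have [g sg] : exists g, sel (inl v) = Some g.
    by rewrite /sel; case: pickP => [g _|/(_ f)]; [exists g | rewrite lf].
  have [_ gn] := linked_vertex v g (inl v) (m (inl v)) (erefl _) (selP _ _ sg).
  have -> : [set e0 in nb_edges v | sel (node_of (v, e0)) != Some e0] = nb_edges v :\ g.
    apply/setP => f'; rewrite in_setD1 in_set nodeE sg andbC.
    by rewrite (inj_eq Some_inj) eq_sym.
  by move: c; rewrite (cardsD1 g) gn => -[].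
have nodeE f : node_of (v, f) = inr (v, f) by rewrite /node_of /= c.
have [f [me fn fe mf only]] := mateP c en.
case: (boolP (is_top v)) => tv.
  left; rewrite -c; congr #|pred_of_set _|; apply/setP => g; rewrite in_set nodeE.
  case gn: (g \in nb_edges v) => //=; apply/eqP => sg.
  have := sel_mate v g; rewrite nodeE => /(_ sg).
  by rewrite minv /= ?eqxx // tv !andbF.
have valid g : g \in nb_edges v -> valid_node (inr (v, g)) by move=> gn; rewrite /= c gn tv.
have [mm|mm] := eqVneq (m (inr (v, e))) (inr (v, f)).
  left; rewrite -c; congr #|pred_of_set _|; apply/setP => g; rewrite in_set.
  case gn: (g \in nb_edges v) => //=; apply/eqP => /sel_mate; rewrite nodeE.
  by case: (only g gn) => ->; [rewrite mm eqxx | rewrite -mm mK eqxx].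
have inM g g' : g \in nb_edges v -> mate (inr (v, g)) = inr (v, g') ->
    m (inr (v, g)) != inr (v, g') -> sel (inr (v, g)) = Some g.
  move=> gn mg ne; have [_ /orP[/existsP[f' lf]|/and3P[_ _]]] := madj _ (valid g gn).
    have [g2 sg] : exists g2, sel (inr (v, g)) = Some g2.
      by rewrite /sel; case: pickP => [g2 _|/(_ f')]; [exists g2 | rewrite lf].
    rewrite sg; have [] := linked_vertex v g2 (inr (v, g)) _ (erefl _) (selP _ _ sg).
    by rewrite nodeE => -[->].
  by rewrite mg (negbTE ne).
right; split.
- apply/eqP; rewrite cards_eq0; apply/eqP/setP => g; rewrite in_set in_set0 nodeE.
  case gn: (g \in nb_edges v) => //=; apply/negbTE; rewrite negbK; apply/eqP.
  case: (only g gn) => ->; first exact: (inM e f).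
  apply: (inM f e) => //; apply: contra mm => /eqP <-.
  by rewrite mK.
- by rewrite c.
- by move=> g tg; move: tv; rewrite /is_top; case/existsP; exists g.
Qed.

End CycleCover.

(** * From major edges to a flow *)

Section MajorEdges.
Import Order.TTheory GRing.Theory Num.Theory.
Local Open Scope ring_scope.

(** Let m be the value of the major edge at a vertex and a, b those of the minor ones. The excess
    is, up to sign, (m - a - b - 1) / 2. It is at least -1/2 as a + b <= m, and at most 1/2 as m <=
    4 and a, b >= 1. *)
Lemma flow_of_major_edges (R : realType) (G : mgraph)
    (mu : vertex G -> edge G) (c : vertex G -> bool) (g : edge G -> nat) :
  cubic G ->
  (forall v, v \in ends (mu v)) ->
  (forall e, 0 < g e <= 4)%N ->
  (forall v, \sum_(e | (v \in ends e) && (e != mu v)) g e <= g (mu v))%N ->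
  (forall e v, v \in ends e -> ~~ bridge e ->
     (c v (+) (mu v == e)) (+) (c (opp_end e v) (+) (mu (opp_end e v) == e))) ->
  admits_bounded_excess_flow G (7 / 2 : R) (1 / 2 : R).
Proof.
move=> cubicG muP gP sumP yP.
(* [y v e] tells whether [e] is to leave [v]. The bridges marked next are those whose ends make
   conflicting demands; [t] reverses all directions on one side of each. *)
pose y v e := c v (+) (mu v == e).
have [t tP] := bridge_gluing (fun e => [exists v in ends e, y v e == y (opp_end e v) e]).
pose y' v e := y v e (+) t v.
have y'P e v : v \in ends e -> y' (opp_end e v) e = ~~ y' v e.
  move=> ve; suff : y' v e (+) y' (opp_end e v) e by case: (y' v e); case: (y' _ e).
  rewrite /y' addbACA tP //; case: (boolP (bridge e)) => be; last by rewrite addbF yP.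
  suff -> : [exists v0 in ends e, y v0 e == y (opp_end e v0) e] = (y v e == y (opp_end e v) e).
    by case: (y v e); case: (y _ e).
  apply/exists_inP/idP => [[w we]|]; last by exists v.
  by case: (ends_cases ve we) => -> //; rewrite oppK // eq_sym.
have tail_ex e : exists v, (v \in ends e) && y' v e.
  have [v ve] := end_exists e; case yv: (y' v e); first by exists v; rewrite ve.
  by exists (opp_end e v); rewrite opp_in // y'P // yv.
pose tl e := xchoose (tail_ex e).
have tlP e : tl e \in ends e /\ y' (tl e) e by apply/andP; exact: (xchooseP (tail_ex e)).
have tlE e v : (tl e == v) = (v \in ends e) && y' v e.
  have [te yt] := tlP e; apply/eqP/andP => [<-//|[ve yv]].
  by case: (ends_cases te ve) => // ev; move: yv; rewrite ev y'P // yt.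
have hdE e v : (opp_end e (tl e) == v) = (v \in ends e) && ~~ y' v e.
  have [te yt] := tlP e; apply/eqP/andP => [<-|[ve yv]].
    by rewrite opp_in // y'P // yt.
  by case: (ends_cases te ve) => // ev; move: yv; rewrite ev yt.
exists (DiGraph tl (fun e => opp_end e (tl e))); split=> [e|].
  by case: (opp_endP (tlP e).1).
exists (fun e => ((g e)%:R + 1) / 2); split=> [e|v].
  have /andP[g0 g4] := gP e.
  have {}g0 : 1 <= (g e)%:R :> R by rewrite ler1n.
  have {}g4 : (g e)%:R <= 4 :> R by rewrite ler_nat.
  by apply/andP; split; lra.
have [a [b [ab minors]]] : exists a b, a != b /\
    (forall e, ((v \in ends e) && (e != mu v)) = (e \in [set a; b])).
  have := cubicG v; rewrite /degree (cardsD1 (mu v)) inE muP => -[/eqP/cards2P[a [b [ab eab]]]].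
  by exists a, b; split=> // e; rewrite -eab !inE andbC.
have y'E e : y' v e = (c v (+) t v) (+) (mu v == e).
  by rewrite /y' /y addbAC.
have outv : out_edges (DiGraph tl (fun e => opp_end e (tl e))) v =
    if c v (+) t v then [set a; b] else [set mu v].
  apply/setP => e; rewrite inE /= tlE y'E; case: (c v (+) t v) => /=.
    by rewrite -minors eq_sym.
  by rewrite inE eq_sym; case: (eqVneq e (mu v)) => [->|_]; rewrite ?muP ?andbF.
have inv : in_edges (DiGraph tl (fun e => opp_end e (tl e))) v =
    if c v (+) t v then [set mu v] else [set a; b].
  apply/setP => e; rewrite inE /= hdE y'E; case: (c v (+) t v) => /=.
    by rewrite inE negbK eq_sym; case: (eqVneq e (mu v)) => [->|_]; rewrite ?muP ?andbF.
  by rewrite -minors eq_sym.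
have sum2 : \sum_(e in [set a; b]) ((g e)%:R + 1) / 2 =
    ((g a)%:R + (g b)%:R + 2) / 2 :> R.
  by rewrite big_setU1 ?inE //= big_set1; field.
have := sumP v; rewrite (eq_bigl _ _ minors) big_setU1 ?inE //= big_set1.
rewrite -(ler_nat R) natrD => le.
have /andP[a1 _] := gP a; have /andP[b1 _] := gP b; have /andP[_ m4] := gP (mu v).
have {}a1 : 1 <= (g a)%:R :> R by rewrite ler1n.
have {}b1 : 1 <= (g b)%:R :> R by rewrite ler1n.
have {}m4 : (g (mu v))%:R <= 4 :> R by rewrite ler_nat.
rewrite outv inv; case: (c v (+) t v); rewrite sum2 big_set1 ler_norml;
  by apply/andP; split; lra.
Qed.

End MajorEdges.

(** * Orienting the cycles *)

Section DirectedCycles.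
Variables (G : mgraph) (F : {set edge G}).
Hypothesis cubicG : cubic G.
Local Notation V := (vertex G).
Local Notation E := (edge G).
Implicit Types (u v w : V) (e : E).

Definition on_cycle v := #|[set e in F | v \in ends e]| == 2.

(** [nx] and [pv] move along the cycles through the edges [ne] and [pe], and [je] is the third edge.
    Being the identity off the cycles, [nx] and [pv] are inverse permutations of all vertices. *)
Record directed_cycles (nx pv : V -> V) (ne pe je : V -> E) : Prop := DirectedCycles {
  dc_nx : forall v, on_cycle v -> nx v = opp_end (ne v) v;
  dc_pv : forall v, on_cycle v -> pv v = opp_end (pe v) v;
  dc_nx_off : forall v, ~~ on_cycle v -> nx v = v;
  dc_pv_off : forall v, ~~ on_cycle v -> pv v = v;
  dc_on_nx : forall v, on_cycle v -> on_cycle (nx v);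
  dc_on_pv : forall v, on_cycle v -> on_cycle (pv v);
  dc_pe_nx : forall v, on_cycle v -> pe (nx v) = ne v;
  dc_ne_pv : forall v, on_cycle v -> ne (pv v) = pe v;
  dc_ne : forall v, on_cycle v -> ne v \in F /\ v \in ends (ne v);
  dc_pe : forall v, on_cycle v -> pe v \in F /\ v \in ends (pe v);
  dc_je : forall v, on_cycle v -> je v \notin F /\ v \in ends (je v);
  dc_neq : forall v, on_cycle v -> ne v != pe v;
  dc_only : forall v e, on_cycle v -> v \in ends e -> [\/ e = ne v, e = pe v | e = je v]
}.

(** On the darts of [F], [al] moves along an edge and [be] turns to the other cycle edge at the same
    vertex. A colouring [d] alternating under both directs the cycles, [d (v, e)] meaning that [e]
    leaves [v]. *)
Lemma directed_cycles_exist :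
  (forall e v, e \in F -> v \in ends e -> on_cycle v) ->
  exists nx pv ne pe je, directed_cycles nx pv ne pe je.
Proof.
move=> Fon.
have [de deP] : exists de : V -> E, forall v, v \in ends (de v).
  apply: (@fin_all_exists V (fun=> E) (fun v e => v \in ends e)) => v.
  have : 0 < degree v by rewrite cubicG.
  by case/card_gt0P=> e /[!inE]; exists e.
pose fm v e := odflt e [pick f in F | (v \in ends f) && (f != e)].
have fmP v e : on_cycle v -> e \in F -> v \in ends e ->
    [/\ fm v e \in F, v \in ends (fm v e), fm v e != e, fm v (fm v e) = e
      & forall f, f \in F -> v \in ends f -> f = e \/ f = fm v e].
  move=> /cards2P[a [b [ab /setP eF]]] eF' ve.
  have ab_in f : (f \in F) && (v \in ends f) = (f == a) || (f == b).
    by move: (eF f); rewrite !inE.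
  have key x z : x != z -> (forall f, (f \in F) && (v \in ends f) = (f == x) || (f == z)) ->
      fm v x = z.
    move=> xz h; rewrite /fm; case: pickP => [f /and3P[fF vf fx]|/(_ z)] /=.
      by have := h f; rewrite fF vf (negbTE fx) /= => /esym/eqP.
    by rewrite andbA h eqxx orbT eq_sym xz.
  have key2 x z : x != z -> e = x ->
      (forall f, (f \in F) && (v \in ends f) = (f == x) || (f == z)) ->
    [/\ fm v e \in F, v \in ends (fm v e), fm v e != e, fm v (fm v e) = e
      & forall f, f \in F -> v \in ends f -> f = e \/ f = fm v e].
    move=> xz -> h; have hz := h z; rewrite eqxx orbT in hz; case/andP: hz => zF vz.
    rewrite (key x z xz h) zF vz eq_sym xz; split=> //.
      by apply: key; rewrite 1?eq_sym // => f; rewrite h orbC.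
    by move=> f fF vf; have := h f; rewrite fF vf => /esym/orP[]/eqP; [left|right].
  have := ab_in e; rewrite eF' ve => /esym/orP[]/eqP ee; first exact: (key2 a b).
  by apply: (key2 b a) => //; rewrite 1?eq_sym // => f; rewrite ab_in orbC.
pose al (d : V * E) := if d.2 \in F then flip d else d.
pose be (d : V * E) :=
  if (d.2 \in F) && (d.1 \in ends d.2) then (d.1, fm d.1 d.2) else d.
have alK : involutive al.
  move=> [v e]; rewrite /al /=; case: (boolP (e \in F)) => eF /=; last by rewrite (negbTE eF).
  have -> : (flip (v, e)).2 = e by rewrite /flip /=; case: ifP.
  by rewrite eF flipK.
have beK : involutive be.
  move=> [v e]; rewrite /be /=; case: (boolP (e \in F)) => eF /=; last by rewrite (negbTE eF).
  case: (boolP (v \in ends e)) => ve /=; last by rewrite eF (negbTE ve).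
  by have [-> -> _ -> _] := fmP v e (Fon e v eF ve) eF ve.
have [d dP] := two_involutions alK beK.
have d_al e v : e \in F -> v \in ends e -> d (opp_end e v, e) = ~~ d (v, e).
  move=> eF ve; have [+ _] := dP (v, e); rewrite /al /= eF /flip /= ve; apply.
  by rewrite xpair_eqE negb_and opp_neq.
have d_be e v : e \in F -> v \in ends e -> d (v, fm v e) = ~~ d (v, e).
  move=> eF ve; have [_ +] := dP (v, e); rewrite /be /= eF ve; apply.
  by have [_ _ ne _ _] := fmP v e (Fon e v eF ve) eF ve; rewrite xpair_eqE negb_and ne orbT.
pose sel b v := odflt (de v) [pick e in F | (v \in ends e) && (d (v, e) == b)].
have selP b v : on_cycle v -> [/\ sel b v \in F, v \in ends (sel b v) & d (v, sel b v) = b].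
  move=> ov; have /card_gt0P[e] : 0 < #|[set e in F | v \in ends e]| by rewrite (eqP ov).
  rewrite inE => /andP[eF ve]; rewrite /sel; case: pickP => [f /and3P[-> -> /eqP] //|no].
  have := no e; have := no (fm v e); have [-> -> _ _ _] := fmP v e ov eF ve.
  by rewrite eF ve d_be //=; case: (d _); case: b {no}.
have selU b v e : e \in F -> v \in ends e -> d (v, e) = b -> sel b v = e.
  move=> eF ve db; have ov := Fon e v eF ve; have [sF vs ds] := selP b v ov.
  have [_ _ _ _ only] := fmP v e ov eF ve; case: (only _ sF vs) => // es.
  by move: ds; rewrite es d_be // db; case: (b).
pose je v := odflt (de v) [pick e | (e \notin F) && (v \in ends e)].
have ne_pe v : on_cycle v -> sel true v != sel false v.
  move=> ov; apply/eqP => e; have [_ _ d1] := selP true v ov; have [_ _ d2] := selP false v ov.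
  by move: d1; rewrite e d2.
have jeP v : on_cycle v -> [/\ je v \notin F, v \in ends (je v) &
    forall e, v \in ends e -> [\/ e = sel true v, e = sel false v | e = je v]].
  move=> ov; have [F1 v1 _] := selP true v ov; have [F2 v2 _] := selP false v ov.
  have [e3 [v3 n1 n2 only]] := third_edge cubicG v1 v2 (ne_pe v ov).
  have [_ _ _ _ onlyF] := fmP v _ ov F1 v1.
  have e3F : e3 \notin F.
    apply/negP=> e3F; case: (onlyF _ e3F v3) => e; first by rewrite e eqxx in n1.
    case: (onlyF _ F2 v2) => e'; first by move: (ne_pe v ov); rewrite e' eqxx.
    by rewrite e -e' eqxx in n2.
  have -> : je v = e3.
    rewrite /je; case: pickP => [e /andP[eF ve]|/(_ e3)] /=; last by rewrite e3F v3.
    by case: (only e ve) => // ee; rewrite ee ?F1 ?F2 in eF.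
  by split.
exists (fun v => if on_cycle v then opp_end (sel true v) v else v).
exists (fun v => if on_cycle v then opp_end (sel false v) v else v).
exists (sel true), (sel false), je.
have opp_on b v : on_cycle v -> on_cycle (opp_end (sel b v) v).
  by move=> ov; have [sF vs _] := selP b v ov; apply: (Fon _ _ sF); rewrite opp_in.
have opp_sel b v : on_cycle v -> sel (~~ b) (opp_end (sel b v) v) = sel b v.
  move=> ov; have [sF vs ds] := selP b v ov; apply: selU => //; first exact: opp_in.
  by rewrite d_al // ds.
split=> //.
- by move=> v ->.
- by move=> v ->.
- by move=> v /negbTE->.
- by move=> v /negbTE->.
- by move=> v ov; rewrite ov opp_on.
- by move=> v ov; rewrite ov opp_on.
- by move=> v ov; rewrite ov (opp_sel true).
- by move=> v ov; rewrite ov (opp_sel false).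
- by move=> v /(selP true)[].
- by move=> v /(selP false)[].
- by move=> v /jeP[].
- by move=> v e /jeP[_ _]; apply.
Qed.

End DirectedCycles.

(** * Labelling the remaining edges *)

Section Labellings.
Variables (G : mgraph) (F : {set edge G}).
Hypothesis cubicG : cubic G.
Local Notation V := (vertex G).
Local Notation E := (edge G).
Variables (nx pv : V -> V) (ne pe je : V -> E).
Hypothesis F_nb : forall e, e \in F -> ~~ bridge e.
Hypothesis F_cover : forall v, #|[set e in F | v \in ends e]| = 2 \/
  [/\ #|[set e in F | v \in ends e]| = 0, #|nb_edges v| <> 3
    & forall e, top v e -> nb_edges v = set0].
Hypothesis dc : directed_cycles F nx pv ne pe je.
Local Notation on := (on_cycle F).
Implicit Types (u v w : V) (e : E) (y : V * E -> bool) (c : V -> bool).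

Lemma F_on e v : e \in F -> v \in ends e -> on v.
Proof.
move=> eF ve; rewrite /on_cycle; case: (F_cover v) => [->//|[+ _ _]].
by move/eqP; rewrite cards_eq0 => /eqP/setP/(_ e); rewrite !inE eF ve.
Qed.

Lemma nxK : cancel nx pv.
Proof.
move=> v; have [ov|ov] := boolP (on v); last by rewrite (dc_nx_off dc ov) (dc_pv_off dc ov).
rewrite (dc_pv dc (dc_on_nx dc ov)) (dc_pe_nx dc ov) (dc_nx dc ov) oppK //.
by case: (dc_ne dc ov).
Qed.

Lemma pvK : cancel pv nx.
Proof.
move=> v; have [ov|ov] := boolP (on v); last by rewrite (dc_pv_off dc ov) (dc_nx_off dc ov).
rewrite (dc_nx dc (dc_on_pv dc ov)) (dc_ne_pv dc ov) (dc_pv dc ov) oppK //.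
by case: (dc_pe dc ov).
Qed.

Lemma nx_neq v : on v -> nx v != v.
Proof. by move=> ov; rewrite (dc_nx dc ov) opp_neq //; case: (dc_ne dc ov). Qed.

Lemma pv_neq v : on v -> pv v != v.
Proof. by move=> ov; rewrite (dc_pv dc ov) opp_neq //; case: (dc_pe dc ov). Qed.

Lemma nx_block v : same_block v (nx v).
Proof.
have [ov|ov] := boolP (on v); last by rewrite (dc_nx_off dc ov) /same_block connect0.
by rewrite (dc_nx dc ov); have [/F_nb nF ?] := dc_ne dc ov; apply: same_block_opp.
Qed.

Lemma pv_block v : same_block v (pv v).
Proof. by have := nx_block (pv v); rewrite pvK /same_block nb_adjacent_sym. Qed.

Lemma cycle_block v w : fconnect nx v w -> same_block v w.
Proof.
move/connectP=> [p + ->]; elim: p v => [|w' p IHp] v /=; first by rewrite /same_block connect0.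
by move=> /andP[/eqP <- /IHp]; apply: connect_trans; exact: nx_block.
Qed.

Lemma je_eq v e : on v -> v \in ends e -> e \notin F -> e = je v.
Proof.
move=> ov ve eF; have [neF _] := dc_ne dc ov; have [peF _] := dc_pe dc ov.
by case: (dc_only dc ov ve) => // ee; move: eF; rewrite ee ?neF ?peF.
Qed.

Definition joining e := (e \notin F) && ~~ bridge e.
Definition lonely v := ~~ on v &&
  [forall e, (joining e && (v \in ends e)) ==> on (opp_end e v)].
(* The middle vertex of three consecutive vertices of the same colour. *)
Definition center c v := [&& on v, c (pv v) == c v & c (nx v) == c v].
Definition cycle_top v := on v && top v (je v).
(** [v] is the middle of a directed path of joining edges. Off the cycles this forces the major edge
    to be joining, since the two minor edges have the same direction. *)
Definition through y v := [exists e, exists e', [&& joining e, joining e',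
  v \in ends e, v \in ends e' & y (v, e) != y (v, e')]].
(** At a cycle vertex the third edge is minor, so that its direction is the colour. *)
Definition colour y v := y (v, je v).

Lemma joining_off v e : ~~ on v -> (e \in nb_edges v) = joining e && (v \in ends e).
Proof.
move=> ov; rewrite inE /joining andbC; case: (boolP (v \in ends e)) => ve; last by rewrite !andbF.
by rewrite !andbT; case: (boolP (e \in F)) => // /F_on/(_ ve); rewrite (negbTE ov).
Qed.

Lemma joining_je v e : on v -> joining e -> v \in ends e -> e = je v.
Proof. by move=> ov /andP[eF _] ve; apply: je_eq. Qed.

Definition jmate v e := odflt e [pick f in nb_edges v :\ e].

Lemma jmateP v e : ~~ on v -> joining e -> v \in ends e ->
  [/\ joining (jmate v e), v \in ends (jmate v e), jmate v e != e,
      jmate v (jmate v e) = e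
    & forall f, joining f -> v \in ends f -> f = e \/ f = jmate v e].
Proof.
move=> ov je' ve; have en : e \in nb_edges v by rewrite joining_off // je' ve.
have c2 : #|nb_edges v| = 2.
  case: (card_nb_edges cubicG en) => // c3.
  by case: (F_cover v) => [oc|[]//]; move: ov; rewrite /on_cycle oc.
have [f [[ef] fn fe [mf] only]] := mateP c2 en.
rewrite -/(jmate v e) in ef; rewrite -/(jmate v f) in mf.
have := fn; rewrite joining_off // => /andP[jf vf].
rewrite ef; split=> // g jg vg; apply: only; by rewrite joining_off // jg.
Qed.

Lemma cycle_top_inj v w : cycle_top v -> cycle_top w -> same_block v w -> v = w.
Proof.
move=> /andP[ov tv] /andP[ow tw] vw; have e := top_block tv tw vw.
have /and3P[b ve _] := tv; have /and3P[_ we _] := tw; rewrite -e in we.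
by case: (ends_cases ve we) => // ww; move: tw; rewrite -e ww top_opp // tv.
Qed.

Lemma cycle_top_bridge v : cycle_top v -> bridge (je v).
Proof. by case/and3P. Qed.

(* [y (v, e)] tells whether [e] leaves [v]; it is unconstrained on bridges, whose
   directions are repaired by [bridge_gluing]. *)
Record admissible y : Prop := Admissible {
  adm_flip : forall e v, joining e -> v \in ends e -> y (opp_end e v, e) = ~~ y (v, e);
  adm_through : forall v e e', ~~ on v -> ~~ lonely v -> joining e -> joining e' ->
    v \in ends e -> v \in ends e' -> e != e' -> y (v, e') = ~~ y (v, e);
  adm_center : forall v w, center (colour y) v -> center (colour y) w ->
    fconnect nx v w -> v = w;
  adm_top : forall v w, center (colour y) v -> cycle_top w -> fconnect nx v w -> False
}.

Lemma fconnect_nx_sym v w : fconnect nx v w = fconnect nx w v.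
Proof. exact: (fconnect_sym (can_inj nxK)). Qed.

(** The labels alternate along joining edges, across vertices off the cycles and between cycle
    vertices paired by [N]. Paired vertices differ in colour, so a centre is the unpaired vertex of
    its cycle, and this is the [cycle_top] if there is one. *)
Lemma admissible_exists : exists y, admissible y.
Proof.
have [N [NK Nadj Nfix Ntop]] : exists N : V -> V,
    [/\ involutive N, forall x, N x = x \/ N x = nx x \/ N x = pv x,
        forall v w, N v = v -> N w = w -> fconnect nx v w -> v = w
      & forall v w, N v = v -> cycle_top w -> fconnect nx v w -> v = w].
  apply: (near_perfect_pairing (B := cycle_top) nxK pvK) => x w tx tw xw.
  by apply: cycle_top_inj tx tw _; apply: cycle_block.
have Non v : on v -> on (N v).
  by move=> ov; case: (Nadj v) => [->//|[->|->]]; [apply: (dc_on_nx dc) | apply: (dc_on_pv dc)].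
pose al (d : V * E) := if joining d.2 then flip d else d.
pose be (d : V * E) :=
  if on d.1 then if d.2 == je d.1 then (N d.1, je (N d.1)) else d
  else if joining d.2 && (d.1 \in ends d.2) then (d.1, jmate d.1 d.2) else d.
have alK : involutive al.
  move=> [v e]; rewrite /al /=; case: (boolP (joining e)) => eJ /=; last by rewrite (negbTE eJ).
  have -> : (flip (v, e)).2 = e by rewrite /flip /=; case: ifP.
  by rewrite eJ flipK.
have beK : involutive be.
  move=> [v e]; rewrite /be /=; case: (boolP (on v)) => ov /=.
    by case: eqP => [->|/eqP/negbTE ne0] /=; [rewrite Non // eqxx NK | rewrite ov ne0].
  case: (boolP (joining e)) => eJ /=; last by rewrite (negbTE ov) (negbTE eJ).
  case: (boolP (v \in ends e)) => ve /=; last by rewrite (negbTE ov) (negbTE ve) andbF.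
  by have [-> -> _ -> _] := jmateP ov eJ ve; rewrite (negbTE ov).
have [y yP] := two_involutions alK beK.
have yN v : on v -> N v != v -> colour y (N v) = ~~ colour y v.
  move=> ov Nv; have [_] := yP (v, je v); rewrite /be /= ov eqxx; apply.
  by rewrite xpair_eqE negb_and Nv.
have cN v : center (colour y) v -> N v = v.
  move=> /and3P[ov /eqP cp /eqP cn]; apply/eqP; case: eqVneq => // Nv.
  have := yN v ov Nv; case: (Nadj v) Nv => [->|[->|->]]; rewrite ?eqxx // ?cp ?cn;
  by case: (colour y v).
(* A centre that is a [cycle_top] can be recoloured because its third edge is a bridge; this
   destroys its triple and creates no other. *)
pose flipped v := cycle_top v && center (colour y) v.
pose z d := if (d.2 == je d.1) && flipped d.1 then ~~ y d else y d.
have zc v : colour z v = if flipped v then ~~ colour y v else colour y v.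
  by rewrite /colour /z /= eqxx.
have zcenter v : center (colour z) v -> center (colour y) v /\ ~~ flipped v.
  move=> /and3P[ov]; rewrite !zc.
  have fu a b : flipped a -> flipped b -> fconnect nx a b -> a = b.
    by move=> /andP[_ /cN Na] /andP[_ /cN Nb]; apply: Nfix.
  have v_nv : fconnect nx v (nx v) by exact: fconnect1.
  have pv_v : fconnect nx (pv v) v by rewrite -{2}(pvK v); exact: fconnect1.
  have [fv|fv] := boolP (flipped v).
    have -> : flipped (nx v) = false.
      by apply/negP => /(fu _ _ fv)/(_ v_nv) e; move: (nx_neq ov); rewrite -e eqxx.
    have /andP[_ /and3P[_ _ /eqP ->]] := fv.
    by move=> _; case: (colour y v).
  have [fp|fp] := boolP (flipped (pv v)).
    by have /andP[_ /and3P[_ _ /eqP]] := fp; rewrite pvK => ->; case: (colour y _).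
  have [fn|fn] := boolP (flipped (nx v)); last by rewrite /center ov => -> ->.
  have /andP[_ /and3P[_ /eqP + _]] := fn; rewrite nxK => ->.
  by move=> _; case: (colour y _).
exists z; split.
- move=> e v eJ ve; have nf w : w \in ends e -> (e == je w) && flipped w = false.
    move=> we; apply/negP => /andP[/eqP ew /andP[/cycle_top_bridge]].
    by move: eJ; rewrite /joining -ew => /andP[_ /negbTE->].
  rewrite /z /= !nf ?opp_in //; have [+ _] := yP (v, e).
  rewrite /al /= eJ /flip /= ve; apply.
  by rewrite xpair_eqE negb_and opp_neq.
- move=> v e e' ov _ eJ eJ' ve ve' ee'.
  have nf : flipped v = false by rewrite /flipped /cycle_top (negbTE ov).
  rewrite /z /= nf !andbF; have [_ _ mne _ only] := jmateP ov eJ ve.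
  have [em|->] := only e' eJ' ve'; first by rewrite em eqxx in ee'.
  have [_ +] := yP (v, e); rewrite /be /= (negbTE ov) eJ ve /=; apply.
  by rewrite xpair_eqE negb_and mne orbT.
- by move=> v w /zcenter[/cN Nv _] /zcenter[/cN Nw _]; apply: Nfix.
- move=> v w /zcenter[cv nf] tw vw; have ev := Ntop v w (cN v cv) tw vw.
  by subst w; move: nf; rewrite /flipped cv tw.
Qed.

(* Recolouring a vertex of a monochromatic triple destroys the triple, or shifts
   it along the cycle; [b] is the centre of the shifted triple. *)
Lemma center_toggle c c' u a :
  (forall w, c' w = c w (+) (w == u)) -> on u ->
  (forall v w, center c v -> center c w -> fconnect nx v w -> v = w) ->
  center c a -> a = u \/ nx a = u \/ pv a = u ->
  exists b, forall v, center c' v ->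
    if fconnect nx u v then v = b else center c v.
Proof.
move=> cc' ou cuniq ca au.
have ua : fconnect nx u a.
  case: au => [->|[<-|<-]]; first exact: connect0.
    by rewrite fconnect_nx_sym fconnect1.
  by rewrite -{2}(pvK a) fconnect1.
have local v : center c' v -> v != u -> nx v != u -> pv v != u -> center c v.
  move=> /and3P[ov + + n1 n2 n3].
  by rewrite !cc' (negbTE n1) (negbTE n2) (negbTE n3) !addbF /center ov => -> ->.
have far v : center c' v -> ~~ fconnect nx u v -> center c v.
  move=> cv uv; apply: local => //; apply: contra uv => /eqP e.
  - by rewrite e connect0.
  - by rewrite -e fconnect_nx_sym fconnect1.
  - by rewrite -e -{2}(pvK v) fconnect1.
have same v : center c' v -> fconnect nx u v -> v != u -> nx v != u -> pv v != u -> v = a.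
  move=> cv uv n1 n2 n3; apply: cuniq; rewrite // ?local //.
  by apply: connect_trans ua; rewrite fconnect_nx_sym.
have [nu pu] : nx u != u /\ pv u != u by rewrite nx_neq // pv_neq.
have at_u v : center c' v -> v = u -> c (pv u) = ~~ c u /\ c (nx u) = ~~ c u.
  move=> /and3P[_ + +] vu; rewrite !cc' vu eqxx (negbTE nu) (negbTE pu) !addbF addbT.
  by move=> /eqP-> /eqP->.
have before_u v : center c' v -> nx v = u -> c (pv u) = ~~ c u.
  move=> /and3P[_ _ +] vu; have ev : v = pv u by rewrite -vu nxK.
  rewrite !cc' vu eqxx ev (negbTE pu) addbF addbT.
  by move=> /eqP->.
have after_u v : center c' v -> pv v = u -> c (nx u) = ~~ c u.
  move=> /and3P[_ + _] vu; have ev : v = nx u by rewrite -vu pvK.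
  rewrite !cc' vu eqxx ev (negbTE nu) addbF addbT.
  by move=> /eqP->.
have [/and3P[oa /eqP cpa /eqP cna]] := conj ca I.
have contra_c x : c x = c u -> c x = ~~ c u -> False by move=> ->; case: (c u).
case: au => [au|[au|au]].
- subst a; exists u => v cv; case: ifP => uv; last by apply: far => //; rewrite uv.
  have n1 : v != u by apply/eqP => /(at_u v cv)[/(contra_c _ cpa)].
  have n2 : nx v != u by apply/eqP => /(before_u v cv)/(contra_c _ cpa).
  have n3 : pv v != u by apply/eqP => /(after_u v cv)/(contra_c _ cna).
  exact: same.
- have cp : c (pv u) = c u by rewrite -{1}au nxK -cna au.
  exists (nx u) => v cv; case: ifP => uv; last by apply: far => //; rewrite uv.
  have n1 : v != u by apply/eqP => /(at_u v cv)[/(contra_c _ cp)].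
  have n2 : nx v != u by apply/eqP => /(before_u v cv)/(contra_c _ cp).
  have [e|n3] := eqVneq (pv v) u; first by rewrite -e pvK.
  by case/eqP: (n2); rewrite (same v cv uv n1 n2 n3) au.
- have cn : c (nx u) = c u by rewrite -{1}au pvK -cpa au.
  exists (pv u) => v cv; case: ifP => uv; last by apply: far => //; rewrite uv.
  have n1 : v != u by apply/eqP => /(at_u v cv)[_ /(contra_c _ cn)].
  have n3 : pv v != u by apply/eqP => /(after_u v cv)/(contra_c _ cn).
  have [e|n2] := eqVneq (nx v) u; first by rewrite -e nxK.
  by case/eqP: (n3); rewrite (same v cv uv n1 n2 n3) au.
Qed.

(** Reversing [e] makes [s] the middle of no directed path. Among cycle vertices only [opp_end e s]
    changes colour; by [center_toggle] its cycle still has at most one triple, and it contains no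
    [cycle_top] because it had the centre [a]. *)
Lemma admissible_improve y s e : admissible y -> lonely s -> through y s ->
  joining e -> s \in ends e ->
  (exists a, center (colour y) a /\
     (a = opp_end e s \/ nx a = opp_end e s \/ pv a = opp_end e s)) ->
  exists z, admissible z /\
    #|[set v | lonely v && through z v]| < #|[set v | lonely v && through y v]|.
Proof.
move=> [yflip ythru ycen ytop] ls ts eJ se [a [ca au]].
set u := opp_end e s in au.
have os : ~~ on s by case/andP: ls.
have ou : on u by case/andP: ls => _ /forallP/(_ e); rewrite eJ se.
have ue : u \in ends e by rewrite opp_in.
have eu : e = je u by apply: joining_je.
pose z (d : V * E) := if d.2 == e then ~~ y d else y d.
have off_e w : w \in ends e -> ~~ on w -> w = s.
  by move=> we ow; case: (ends_cases se we) => // ew; move: ow; rewrite ew ou.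
have zc w : on w -> colour z w = colour y w (+) (w == u).
  move=> ow; rewrite /colour /z /=; case: (eqVneq w u) => [->|wu].
    by rewrite -eu eqxx addbT.
  rewrite addbF; case: eqP => // ew; move: wu; have [_ wje] := dc_je dc ow.
  rewrite ew in wje; case: (ends_cases se wje) => [ws|->]; last by rewrite eqxx.
  by move: ow; rewrite ws (negbTE os).
(* Off the cycles [je] is arbitrary; keeping the old colour there makes [u] the only vertex where
   the colours differ. *)
pose c' w := if on w then colour z w else colour y w.
have cc' w : c' w = colour y w (+) (w == u).
  rewrite /c'; case: ifP => ow; first exact: zc.
  by case: (eqVneq w u) => [wu|_]; [move: ow; rewrite wu ou | rewrite addbF].
have cenE w : center (colour z) w = center c' w.
  rewrite /center /c'; case: (boolP (on w)) => //= ow.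
  by rewrite (dc_on_nx dc ow) (dc_on_pv dc ow).
have [b bP] := center_toggle cc' ou ycen ca au.
have ua : fconnect nx u a.
  case: au => [->|[<-|<-]]; first exact: connect0.
    by rewrite fconnect_nx_sym fconnect1.
  by rewrite -{2}(pvK a) fconnect1.
exists z; split; first split.
- move=> f v fJ vf; rewrite /z /= yflip //; by case: eqP.
- move=> v f f' ov lv fJ fJ' vf vf' ff'; rewrite /z /= (ythru v f f') //.
  have nv g : v \in ends g -> (g == e) = false.
    move=> vg; apply/negbTE; apply: contra lv => /eqP ge; rewrite ge in vg.
    by rewrite (off_e v vg ov).
  by rewrite !nv.
- move=> v w; rewrite !cenE => /bP + /bP; case: ifP => uv cv.
    case: ifP => uw cw vw; first by rewrite cv cw.
    by have := connect_trans uv vw; rewrite uw.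
  case: ifP => uw cw vw; last exact: ycen.
  by move: uv; rewrite (connect_trans uw) // fconnect_nx_sym.
- move=> v w; rewrite cenE => /bP; case: ifP => uv cv tw vw; last exact: (ytop v w).
  apply: (ytop a w) => //; apply: connect_trans (connect_trans uv vw).
  by rewrite fconnect_nx_sym.
apply: proper_card; apply/properP; split.
  apply/subsetP => v; rewrite !inE => /andP[lv]; rewrite lv /=.
  case/existsP=> f /existsP[f' /and5P[fJ fJ' vf vf']]; have [->//|vs] := eqVneq v s.
  have nv g : v \in ends g -> (g == e) = false.
    move=> vg; apply/eqP => ge; rewrite ge in vg; case/andP: lv => ov _.
    by move: vs; rewrite (off_e v vg ov) eqxx.
  rewrite /z /= !nv // => ne'.
  by apply/existsP; exists f; apply/existsP; exists f'; rewrite fJ fJ' vf vf'.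
exists s; rewrite !inE ls ?ts //=.
have [mJ sm mne _ only] := jmateP os eJ se.
have yne : y (s, jmate s e) = ~~ y (s, e).
  case/existsP: ts => f /existsP[f' /and5P[fJ fJ' sf sf']].
  case: (only f fJ sf) (only f' fJ' sf') => -> [] ->; rewrite ?eqxx //;
    by case: (y _); case: (y _).
have zeq f : joining f -> s \in ends f -> z (s, f) = ~~ y (s, e).
  move=> fJ sf; rewrite /z /=; case: (only f fJ sf) => ->; first by rewrite eqxx.
  by rewrite (negbTE mne).
apply/negP=> /existsP[f /existsP[f' /and5P[fJ fJ' sf sf']]].
by rewrite !zeq // eqxx.
Qed.

(** Descent by [admissible_improve]: when it stops, no triple contains an end of a directed path
    through a lonely vertex. *)
Lemma admissible_tame : exists y, admissible y /\
  forall s e a, lonely s -> through y s -> joining e -> s \in ends e ->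
    center (colour y) a ->
    [/\ a <> opp_end e s, nx a <> opp_end e s & pv a <> opp_end e s].
Proof.
have [y0 y0P] := admissible_exists.
have [n] := ubnP #|[set v | lonely v && through y0 v]|.
elim: n y0 y0P => // n IHn y yP; rewrite ltnS => le.
have [/existsP[s /existsP[e /existsP[a /and5P[ls ts eJ se /andP[ca near]]]]]|no] :=
  boolP [exists s, exists e, exists a, [&& lonely s, through y s, joining e,
    s \in ends e & center (colour y) a &&
    [|| a == opp_end e s, nx a == opp_end e s | pv a == opp_end e s]]].
  have [|z [zP lt]] := admissible_improve yP ls ts eJ se.
    by exists a; split=> //; case/or3P: near => /eqP; [left | right; left | right; right].
  by apply: (IHn z) => //; apply: leq_trans lt le.
exists y; split=> // s e a ls ts eJ se ca.
split=> h; case/negP: no; apply/existsP; exists s; apply/existsP; exists e;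
  by apply/existsP; exists a; rewrite ls ts eJ se ca h eqxx ?orbT.
Qed.


(** [chi] marks the cycle vertices on which a vertex may be hooked. It alternates under [W],
    exchanging the ends of a directed path through a lonely vertex, and under [R], exchanging the
    vertices of a run of length two. Both preserve blocks, and a block has at most one [cycle_top],
    so negation on the [bad] blocks makes [chi] true at the tops. *)
Lemma hooks_exist y : exists chi : V -> bool,
  [/\ forall x, cycle_top x -> chi x,
      forall s e e', lonely s -> through y s -> joining e -> joining e' ->
        s \in ends e -> s \in ends e' -> e != e' ->
        chi (opp_end e' s) = ~~ chi (opp_end e s)
    & forall v, on v -> colour y (nx v) = colour y v ->
        ~~ center (colour y) v -> ~~ center (colour y) (nx v) ->
        chi (nx v) = ~~ chi v].
Proof.
set c := colour y.
pose hooked v := [&& on v, joining (je v), lonely (opp_end (je v) v)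
                   & through y (opp_end (je v) v)].
pose W v := if hooked v then opp_end (jmate (opp_end (je v) v) (je v)) (opp_end (je v) v)
            else v.
pose R v := if ~~ on v || center c v then v
  else if (c (nx v) == c v) && ~~ center c (nx v) then nx v
  else if (c (pv v) == c v) && ~~ center c (pv v) then pv v else v.
have WP v : hooked v -> [/\ hooked (W v), W (W v) = v, W v != v & same_block v (W v)].
  move=> hv; have /and4P[ov jJ ls ts] := hv.
  have [_ vj] := dc_je dc ov; set s := opp_end (je v) v in ls ts *.
  have os : ~~ on s by case/andP: ls.
  have sj : s \in ends (je v) by apply: opp_in.
  have [mJ ms mne mm _] := jmateP os jJ sj.
  set f := jmate s (je v) in mJ ms mne mm *.
  have wf : opp_end f s \in ends f by apply: opp_in.
  have ow : on (opp_end f s) by case/andP: ls => _ /forallP/(_ f); rewrite mJ ms.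
  have fw : je (opp_end f s) = f by rewrite -(joining_je ow mJ wf).
  have hw : hooked (opp_end f s) by rewrite /hooked ow fw mJ oppK // ls ts.
  have Wv : W v = opp_end f s by rewrite /W hv.
  rewrite Wv; split=> //.
  - by rewrite /W hw fw oppK // mm oppK.
  - by apply/eqP => e; move: mne; rewrite -fw e eqxx.
  - apply: same_block_trans (same_block_opp _ ms); last by case/andP: mJ.
    by apply: same_block_opp; [case/andP: jJ | case: (dc_je dc ov)].
have WK : involutive W.
  move=> v; case: (boolP (hooked v)) => hv; first by case: (WP v hv).
  by rewrite /W (negbTE hv) (negbTE hv).
have RK : involutive R.
  move=> v; rewrite {2}/R; case: (boolP (~~ on v)) => /= ov; first by rewrite /R ov.
  rewrite negbK in ov.
  case: (boolP (center c v)) => cv; first by rewrite /R cv orbT.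
  case: ifP => [/andP[/eqP en cn]|hn].
    rewrite /R (dc_on_nx dc ov) (negbTE cn) /= nxK en eqxx cv.
    by case: eqP => //= enn; case/negP: cn; rewrite /center (dc_on_nx dc ov) nxK enn en eqxx.
  case: ifP => [/andP[/eqP ep cp]|hp]; last by rewrite /R ov (negbTE cv) hn hp.
  by rewrite /R (dc_on_pv dc ov) (negbTE cp) /= pvK ep eqxx cv.
have Rblock v : same_block v (R v).
  rewrite /R; case: ifP => _; first exact: same_block_refl.
  case: ifP => _; first exact: nx_block.
  by case: ifP => _; [exact: pv_block | exact: same_block_refl].
have Wblock v : same_block v (W v).
  case: (boolP (hooked v)) => hv; first by case: (WP v hv).
  by rewrite /W (negbTE hv); exact: same_block_refl.
have [d dP] := two_involutions WK RK.
pose bad v := [exists x, [&& cycle_top x, same_block x v & ~~ d x]].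
have bad_block v w : same_block v w -> bad w = bad v.
  move=> vw; apply: eq_existsb => x; congr [&& _, _ & _].
  apply/idP/idP => xv; last exact: same_block_trans vw.
  by apply: same_block_trans xv _; rewrite same_block_sym.
exists (fun v => d v (+) bad v); split.
- move=> x tx; suff -> : bad x = ~~ d x by case: (d x).
  apply/existsP/idP => [[x' /and3P[tx' xx' +]]|dx].
    by rewrite (cycle_top_inj tx' tx xx').
  by exists x; rewrite tx dx andbT; exact: same_block_refl.
- move=> s e e' ls ts eJ eJ' se se' ee'; set v := opp_end e s.
  have ov : on v by case/andP: ls => _ /forallP/(_ e); rewrite eJ se.
  have os : ~~ on s by case/andP: ls.
  have ve : v \in ends e by apply: opp_in.
  have ev : je v = e by rewrite -(joining_je ov eJ ve).
  have sv : opp_end (je v) v = s by rewrite ev oppK.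
  have hv : hooked v by rewrite /hooked sv ov ev eJ ls ts.
  have Wv : W v = opp_end e' s.
    rewrite /W hv sv ev; have [_ _ _ _ only] := jmateP os eJ se.
    by case: (only e' eJ' se') => [e1|<-//]; rewrite e1 eqxx in ee'.
  have [_ _ Wne _] := WP v hv; have [dW _] := dP v.
  by rewrite -Wv (bad_block _ _ (Wblock v)) (dW Wne) addNb.
- move=> v ov en cv cn; have Rv : R v = nx v by rewrite /R ov (negbTE cv) /= en eqxx cn.
  have [_ dR] := dP v; rewrite Rv (nx_neq ov) in dR.
  by rewrite (bad_block _ _ (nx_block v)) dR // addNb.
Qed.

(** A vertex off the cycles is incident either with three bridges, at most one of which leads
    towards the root, or with a single bridge, and then it is no top by [F_cover]. *)
Lemma nontop_bridge v : ~~ on v ->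
  exists e, [&& bridge e, v \in ends e & ~~ top v e].
Proof.
move=> ov; have [nb0|[f fn]] := set_0Vmem (nb_edges v).
  have br e : v \in ends e -> bridge e.
    by move=> ve; case: (boolP (bridge e)) => // be; move/setP/(_ e): nb0; rewrite !inE ve be.
  have : 1 < degree v by rewrite cubicG.
  case/card_gt1P=> a [b []]; rewrite !inE => va vb ab.
  case: (boolP (top v a)) => ta; last by exists a; rewrite br // va ta.
  exists b; rewrite br // vb; apply/negP => tb; case/negP: ab; apply/eqP.
  by apply: top_block ta tb _; exact: same_block_refl.
have nt e : ~~ top v e.
  apply/negP => te; case: (F_cover v) => [c2|[_ _ /(_ e te) n0]].
    by move: ov; rewrite /on_cycle c2.
  by move: fn; rewrite n0 inE.
have c3 := cubicG v; rewrite /degree in c3.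
have : nb_edges v \proper [set e | v \in ends e].
  rewrite properEcard; apply/andP; split.
    by apply/subsetP => e; rewrite !inE => /andP[].
  case: (F_cover v) => [c2|[_ n3 _]]; first by move: ov; rewrite /on_cycle c2.
  by rewrite c3; case: (card_nb_edges cubicG fn) => [->|/n3].
case/properP=> _ [e]; rewrite !inE => ve; rewrite ve negbK => be.
by exists e; rewrite be ve nt.
Qed.

(** * Choosing the major edges for a fixed labelling *)

Section MajorEdgeChoice.
Variables (y : V * E -> bool) (chi : V -> bool).
Hypothesis yP : admissible y.
Hypothesis y_tame : forall s e a, lonely s -> through y s -> joining e -> s \in ends e ->
  center (colour y) a ->
  [/\ a <> opp_end e s, nx a <> opp_end e s & pv a <> opp_end e s].
Hypothesis chi_top : forall x, cycle_top x -> chi x.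
Hypothesis chi_through : forall s e e', lonely s -> through y s -> joining e -> joining e' ->
  s \in ends e -> s \in ends e' -> e != e' -> chi (opp_end e' s) = ~~ chi (opp_end e s).
Hypothesis chi_run : forall v, on v -> colour y (nx v) = colour y v ->
  ~~ center (colour y) v -> ~~ center (colour y) (nx v) -> chi (nx v) = ~~ chi v.
Local Notation c := (colour y).

(** The joining edges at such a vertex, if any, have the same direction, so its major edge has to be
    a bridge. *)
Definition needy v := lonely v && ~~ through y v.
Definition pairable e := [exists v in ends e, [&& ~~ on v, ~~ on (opp_end e v)
  & ~~ bridge e || (needy v && needy (opp_end e v))]].

Lemma pairableE e v : v \in ends e -> pairable e =
  [&& ~~ on v, ~~ on (opp_end e v) & ~~ bridge e || (needy v && needy (opp_end e v))].
Proof.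
move=> ve; apply/exists_inP/idP => [[w we]|]; last by exists v.
case: (ends_cases ve we) => -> //; rewrite oppK // => /and3P[-> -> /=].
by rewrite [needy _ && _]andbC.
Qed.

Definition pairing (M : {set E}) := (M \subset pairable) &&
  [forall v, #|[set e in M | v \in ends e]| <= 1].

Lemma pairing_uniq M v e e' : pairing M -> e \in M -> e' \in M ->
  v \in ends e -> v \in ends e' -> e = e'.
Proof.
move=> /andP[_ /forallP/(_ v)/card_le1_eqP h] eM eM' ve ve'.
by apply: h; rewrite inE ?eM ?eM'.
Qed.

Definition matched (M : {set E}) v := [exists e in M, v \in ends e].

Lemma maximal_pairing : exists2 M, pairing M &
  forall e v, pairable e -> v \in ends e -> matched M v || matched M (opp_end e v).
Proof.
have p0 : pairing set0.
  apply/andP; split; first by apply/subsetP => e; rewrite inE.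
  apply/forallP => v; suff -> : [set e in set0 | v \in ends e] = set0 by rewrite cards0.
  by apply/setP => e; rewrite !inE.
have [M MP Mmax] := arg_maxnP (fun M : {set E} => #|M|) p0.
exists M => // e v eP ve; apply: contraT; rewrite negb_or => /andP[nv nw].
have eM : e \notin M by apply: contra nv => eM; apply/exists_inP; exists e.
suff /Mmax : pairing (e |: M) by rewrite /= cardsU1 eM /= add1n ltnn.
have /andP[sub /forallP one] := MP.
apply/andP; split; first by apply/subsetP => f; rewrite !inE => /orP[/eqP->|/(subsetP sub)].
apply/forallP => w; case: (boolP (w \in ends e)) => we.
  have nm : ~~ matched M w by case: (ends_cases ve we) => ->.
  rewrite -(cards1 e); apply: subset_leq_card; apply/subsetP => f.
  rewrite !inE => /andP[/orP[//|fM] wf]; case/negP: nm.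
  by apply/exists_inP; exists f.
apply: leq_trans (one w); apply: subset_leq_card; apply/subsetP => f.
by rewrite !inE => /andP[/orP[/eqP ef|->//] wf]; move: we; rewrite -ef wf.
Qed.

Lemma through_jmate v e : ~~ on v -> joining e -> v \in ends e ->
  (y (v, jmate v e) == ~~ y (v, e)) = through y v.
Proof.
move=> ov eJ ve; have [mJ vm _ _ only] := jmateP ov eJ ve.
apply/eqP/idP => [ym|/existsP[f /existsP[f' /and5P[fJ fJ' vf vf']]]].
  apply/existsP; exists e; apply/existsP; exists (jmate v e).
  by rewrite eJ mJ ve vm ym; case: (y _).
by case: (only f fJ vf) (only f' fJ' vf') => -> [] ->; rewrite ?eqxx //;
  case: (y _); case: (y _).
Qed.

Section Choice.
Variable M : {set E}.
Hypothesis M_pairing : pairing M.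
Hypothesis M_max : forall e v, pairable e -> v \in ends e ->
  matched M v || matched M (opp_end e v).

(** In this order: the edge to a partner; an edge to a vertex that has a partner, by maximality; a
    bridge away from the root, which then ends at a [cycle_top]; an edge of the directed path
    through [v], to the end allowed by [chi]. *)
Inductive off_choice v e : Prop :=
| ChoiceMatched of e \in M
| ChoicePairable of ~~ matched M v & pairable e
| ChoiceBridge of needy v & (forall f, v \in ends f -> ~~ pairable f)
    & bridge e & ~~ top v e
| ChoiceHook of lonely v & through y v & joining e & chi (opp_end e v).

Lemma off_choice_exists v : ~~ on v -> exists e, v \in ends e /\ off_choice v e.
Proof.
move=> ov; have [/exists_inP[e eM ve]|nm] := boolP (matched M v).
  by exists e; split=> //; constructor 1.
have [/existsP[e /andP[eP ve]]|np] := boolP [exists e, pairable e && (v \in ends e)].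
  by exists e; split=> //; constructor 2.
have {}np f : v \in ends f -> ~~ pairable f.
  by move=> vf; apply: contra np => pf; apply/existsP; exists f; rewrite pf.
have [nv|nn] := boolP (needy v).
  have [e /and3P[be ve te]] := nontop_bridge ov.
  by exists e; split=> //; constructor 3.
have lv : lonely v.
  rewrite /lonely ov; apply/forallP => e; apply/implyP => /andP[eJ ve].
  apply: contraT => ow; move: (np e ve); rewrite (pairableE ve) ov ow.
  by case/andP: eJ => _ ->.
have tv : through y v by move: nn; rewrite /needy lv negbK.
have [e [e' [eJ eJ' ve ve' ee']]] : exists e e',
    [/\ joining e, joining e', v \in ends e, v \in ends e' & e != e'].
  case/existsP: tv => e /existsP[e' /and5P[eJ eJ' ve ve' ye]].
  by exists e, e'; split=> //; apply: contraNneq ye => ->.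
have := chi_through lv tv eJ eJ' ve ve' ee'.
case ce: (chi (opp_end e v)) => ce'; first by exists e; split=> //; constructor 4.
by exists e'; split=> //; constructor 4.
Qed.

Section Major.
Variable mu : V -> E.
Hypothesis mu_on : forall v, on v -> mu v = if c v then pe v else ne v.
Hypothesis mu_off : forall v, ~~ on v -> v \in ends (mu v) /\ off_choice v (mu v).

Lemma mu_ends v : v \in ends (mu v).
Proof.
have [ov|/mu_off[]//] := boolP (on v); rewrite mu_on //.
by case: (c v); [case: (dc_pe dc ov) | case: (dc_ne dc ov)].
Qed.

Lemma mu_on_F v : on v -> mu v \in F.
Proof.
move=> ov; rewrite mu_on //.
by case: (c v); [case: (dc_pe dc ov) | case: (dc_ne dc ov)].
Qed.

Lemma off_F v e : ~~ on v -> v \in ends e -> e \notin F.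
Proof. by move=> ov ve; apply: contra ov => /F_on; apply. Qed.

Lemma M_pairable e : e \in M -> pairable e.
Proof. by case/andP: M_pairing => /subsetP sub _ /sub. Qed.

Lemma lonely_pairable e v : lonely v -> v \in ends e -> pairable e -> needy v.
Proof.
move=> lv ve; rewrite (pairableE ve) => /and3P[ov ow /orP[be|/andP[]//]].
case/andP: lv => _ /forallP/(_ e).
by rewrite /joining (off_F ov ve) be ve /= (negbTE ow).
Qed.

Lemma mu_matched e v : e \in M -> v \in ends e -> mu v = e.
Proof.
move=> eM ve; have eP := M_pairable eM.
have /and3P[ov ow _] : [&& ~~ on v, ~~ on (opp_end e v) & true].
  by move: eP; rewrite (pairableE ve) => /and3P[-> ->].
have [vm [mM|nm _|_ np _ _|lv tv _ _]] := mu_off ov.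
- exact: (pairing_uniq M_pairing mM eM vm ve).
- by case/negP: nm; apply/exists_inP; exists e.
- by case/negP: (np e ve).
- by have /andP[_ /negP] := lonely_pairable lv ve eP.
Qed.

(** A hook along a pairable edge ends at a matched vertex, whose major edge is major at both ends. A
    bridge away from the root that ended off the cycles would reach a vertex with bridges only; this
    is [needy], so the bridge would be pairable. A hook chosen by [chi] ends on a cycle. *)
Lemma mu_unhooked v e : ~~ on v -> v \in ends e -> e != mu v ->
  mu (opp_end (mu v) v) != mu v -> mu (opp_end e v) != e.
Proof.
move=> ov ve em nd; apply/eqP => me; set w := opp_end e v in me.
have we : w \in ends e by apply: opp_in.
have eF := off_F ov ve.
have ow : ~~ on w by apply: contra eF => /mu_on_F; rewrite me.
have wv : opp_end e w = v by rewrite oppK.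
have [_] := mu_off ow; rewrite me => -[eM|nm eP|nw np be nt|lw _ eJ _].
- by move: em; rewrite (mu_matched eM ve) eqxx.
- have := M_max eP we; rewrite (negbTE nm) wv => /exists_inP[f fM vf].
  have mf := mu_matched fM vf; move: nd; rewrite mf.
  by rewrite (mu_matched fM (opp_in vf)) eqxx.
- have tv : top v e by rewrite -wv top_opp.
  case/negP: (np e we); rewrite (pairableE we) ow wv ov nw /=.
  have nb0 : nb_edges v = set0.
    by case: (F_cover v) => [c2|[_ _ /(_ e tv)//]]; move: ov; rewrite /on_cycle c2.
  have nj f : joining f -> v \in ends f -> False.
    by move=> fJ vf; have := joining_off f ov; rewrite nb0 inE fJ vf.
  have lv : lonely v.
    by rewrite /lonely ov; apply/forallP => f; apply/implyP => /andP[/nj fJ /fJ].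
  rewrite /needy lv /= orbC.
  have -> // : ~~ through y v.
  by apply/negP => /existsP[f /existsP[f' /and5P[/nj fJ _ /fJ]]].
- by case/andP: lw => _ /forallP/(_ e); rewrite eJ we wv (negbTE ov).
Qed.

(** Off the cycles every joining edge determines the colour, consistently by [final_colourP]; a
    vertex with bridges only gets [false]. *)
Definition final_colour v := if on v then c v
  else [exists e, [&& joining e, v \in ends e & y (v, e) (+) (mu v == e)]].

Lemma final_colourP v e : joining e -> v \in ends e ->
  final_colour v (+) (mu v == e) = y (v, e).
Proof.
move=> eJ ve; rewrite /final_colour; have [ov|ov] := boolP (on v).
  rewrite /colour -(joining_je ov eJ ve).
  have -> : (mu v == e) = false; last by rewrite addbF.
  by apply/negbTE; apply: contraTneq eJ => <-; rewrite /joining mu_on_F.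
have [mJ vm mne _ only] := jmateP ov eJ ve; set f := jmate v e in mJ vm mne only.
suff ef : y (v, f) (+) (mu v == f) = y (v, e) (+) (mu v == e).
  have -> : [exists e', [&& joining e', v \in ends e' & y (v, e') (+) (mu v == e')]] =
      y (v, e) (+) (mu v == e).
    apply/existsP/idP => [[g /and3P[gJ vg]]|]; last by exists e; rewrite eJ ve.
    by case: (only g gJ vg) => ->; rewrite ?ef.
  by rewrite -addbA addbb addbF.
have [vmu ch] := mu_off ov.
have yt := through_jmate ov eJ ve; rewrite -/f in yt.
have muF := off_F ov vmu.
have of_pairable : pairable (mu v) -> through y v = joining (mu v).
  rewrite (pairableE vmu) /joining muF => /and3P[_ ow].
  case: (boolP (bridge (mu v))) => [_ /andP[/andP[_ /negbTE] //]|bm _] /=.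
  have muJ : joining (mu v) by rewrite /joining muF.
  have nl : ~~ lonely v.
    by apply/negP => /andP[_ /forallP/(_ (mu v))]; rewrite muJ vmu (negbTE ow).
  by rewrite -yt (adm_through yP ov nl eJ mJ ve vm) ?eqxx // eq_sym.
(* Every kind of choice makes the major edge joining exactly when [v] is the middle of a directed
   path. *)
have key : through y v = joining (mu v).
  case: ch => [/M_pairable|_|/andP[_ /negbTE->] _ bm _|_ -> ->//]; try exact: of_pairable.
  by rewrite /joining bm andbF.
have [muJ|muJ] := boolP (joining (mu v)).
  rewrite muJ in key; rewrite key in yt; move/eqP: yt => ->.
  have fe : (f == e) = false by apply/negbTE.
  have ef : (e == f) = false by rewrite eq_sym.
  by case: (only (mu v) muJ vmu) => ->; rewrite eqxx ?fe ?ef; case: (y _).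
have nm g : joining g -> (mu v == g) = false.
  by move=> gJ; apply/negbTE; apply: contraNneq muJ => ->.
rewrite !nm // !addbF; move: yt; rewrite key (negbTE muJ).
by case: (y (v, f)); case: (y (v, e)).
Qed.

Lemma final_colour_arc v : on v ->
  final_colour v (+) (mu v == ne v) /\ ~~ (final_colour v (+) (mu v == pe v)).
Proof.
move=> ov; rewrite /final_colour ov mu_on //; have nepe := dc_neq dc ov.
by case: (c v); rewrite ?eqxx ?(negbTE nepe) // eq_sym (negbTE nepe).
Qed.

Lemma final_colour_nb e v : v \in ends e -> ~~ bridge e ->
  (final_colour v (+) (mu v == e))
    (+) (final_colour (opp_end e v) (+) (mu (opp_end e v) == e)).
Proof.
move=> ve be; have [eF|eF] := boolP (e \in F); last first.
  have eJ : joining e by rewrite /joining eF.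
  rewrite !final_colourP ?opp_in // (adm_flip yP eJ ve).
  by case: (y _).
have ov := F_on eF ve; case: (dc_only dc ov ve) => ee; subst e.
- have [h _] := final_colour_arc ov; rewrite h -(dc_nx dc ov) -(dc_pe_nx dc ov).
  by have [_] := final_colour_arc (dc_on_nx dc ov).
- have [_ /negbTE h] := final_colour_arc ov; rewrite h -(dc_pv dc ov) -(dc_ne_pv dc ov).
  by have [] := final_colour_arc (dc_on_pv dc ov).
- by case: (dc_je dc ov); rewrite eF.
Qed.

(** * Values of the edges and the inequality at each vertex *)

Definition hooked v := mu (opp_end (je v) v) == je v.

Lemma hookedP v : on v -> hooked v ->
  cycle_top v \/
  [/\ joining (je v), lonely (opp_end (je v) v), through y (opp_end (je v) v) & chi v].
Proof.
move=> ov /eqP hv; have [jF vj] := dc_je dc ov; set s := opp_end (je v) v in hv *.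
have sj : s \in ends (je v) by apply: opp_in.
have os : ~~ on s by apply: contra jF => /mu_on_F; rewrite hv.
have sv : opp_end (je v) s = v by rewrite oppK.
have np : ~~ pairable (je v) by rewrite (pairableE vj) ov.
have [_] := mu_off os; rewrite hv => -[/M_pairable|_|_ _ be nt|ls ts jJ]; rewrite ?(negbTE np) //.
  by left; have := top_opp be sj; rewrite sv nt /cycle_top ov.
by rewrite sv; right.
Qed.

(** On a triple, hooks at a [cycle_top] are excluded by [adm_top] and hooks of lonely vertices by
    [y_tame]. *)
Lemma hooked_far v a : center c a -> a = v \/ nx a = v \/ pv a = v -> hooked v = false.
Proof.
move=> ca av; have oa : on a by case/and3P: ca.
have ov : on v.
  by case: av => [<-//|[<-|<-]]; [apply: (dc_on_nx dc) | apply: (dc_on_pv dc)].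
apply/negP => /(hookedP ov)[tv|[jJ ls ts _]].
  apply: (adm_top yP ca tv); case: av => [->|[<-|<-]]; first exact: connect0.
    exact: fconnect1.
  by rewrite fconnect_nx_sym -{2}(pvK a) fconnect1.
have [_ vj] := dc_je dc ov.
have := y_tame ls ts jJ (opp_in vj) ca; rewrite oppK // => -[n1 n2 n3].
by case: av => [|[]].
Qed.

Lemma center_nx v : on v -> c (nx v) (+) c v || (c (nx (nx v)) (+) c v) = false ->
  center c (nx v).
Proof.
move=> ov; rewrite /center (dc_on_nx dc ov) nxK.
by case: (c v); case: (c (nx v)); case: (c (nx (nx v))).
Qed.

(** Like [run3] and [run4], this is a boolean disjunction, ready for the exhaustive check in
    [minors_on]. Hooked vertices satisfy [chi], which alternates on a run of length two. *)
Lemma run2 v : on v -> c (nx v) (+) c v || (hooked v + hooked (nx v) <= 1).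
Proof.
move=> ov; case e : (c (nx v) (+) c v) => //=.
have {}e : c (nx v) = c v by move: e; case: (c v); case: (c _).
have [cv|cv] := boolP (center c v); first by rewrite !(hooked_far cv) //; [right; left | left].
have [cn|cn] := boolP (center c (nx v)).
  by rewrite !(hooked_far cn) //; [left | right; right; rewrite nxK].
have chi_hooked w : on w -> hooked w -> chi w.
  by move=> ow /(hookedP ow)[/chi_top|[]].
have := chi_run ov e cv cn.
case hv: (hooked v); case hn: (hooked (nx v)) => //.
by rewrite (chi_hooked v ov hv) (chi_hooked _ (dc_on_nx dc ov) hn).
Qed.

Lemma run3 v : on v -> c (nx v) (+) c v || (c (nx (nx v)) (+) c v)
  || (hooked v + hooked (nx v) + hooked (nx (nx v)) <= 0).
Proof.
move=> ov; case: (boolP (c (nx v) (+) c v || _)) => //= /negbTE h; have cn := center_nx ov h.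
by rewrite !(hooked_far cn) //; [right; left | left | right; right; rewrite nxK].
Qed.

(** Four equal colours in a row would give two consecutive centres on one cycle, against
    [adm_center]. *)
Lemma run4 v : on v -> c (nx v) (+) c v || (c (nx (nx v)) (+) c v)
  || (c (nx (nx (nx v))) (+) c v).
Proof.
move=> ov; case: (boolP (_ || (c (nx (nx v)) (+) c v))) => //= /negbTE h; apply: contraT => h4.
have c1 := center_nx ov h.
have c2 : center c (nx (nx v)).
  apply: center_nx; first exact: (dc_on_nx dc).
  by move: h h4; case: (c v); case: (c (nx v)); case: (c (nx (nx v))); case: (c (nx (nx (nx v)))).
have := adm_center yP c1 c2 (fconnect1 _ _) => e.
by have := nx_neq (dc_on_nx dc ov); rewrite -e eqxx.
Qed.

(* The arc from [v] to [nx v].  Between two vertices of the same colour, the one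
   for which it is major is hooked on the other one, and the value is one more
   than the number of vertices hanging there. *)
Definition arc_value v :=
  if c (nx v) (+) c v then if c v then 1 else 4
  else if c v then 2 + hooked (nx v) + (if c (nx (nx v)) then 1 + hooked (nx (nx v)) else 0)
  else 2 + hooked v + (if c (pv v) then 0 else 1 + hooked (pv v)).

(** The value 2 is enough for a vertex off the cycles whose major edge is major there only: by
    [mu_unhooked] both of its minor edges have value 1. *)
Definition join_value e :=
  let k := \sum_(v in ends e) (mu v == e) in
  if k == 0 then 1 else if k == 1 then 2 else 4.

Definition edge_value e :=
  if [pick v | on v && (ne v == e)] is Some v then arc_value v else join_value e.

Lemma edge_value_ne v : on v -> edge_value (ne v) = arc_value v.
Proof.
move=> ov; rewrite /edge_value; case: pickP => [w /andP[ow /eqP e]|/(_ v)]; last by rewrite ov eqxx.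
have [_ vn] := dc_ne dc ov; have [_ wn] := dc_ne dc ow; rewrite e in wn.
case: (ends_cases vn wn) => [->//|]; rewrite -(dc_nx dc ov) => wv.
by have := dc_neq dc ow; rewrite e wv (dc_pe_nx dc ov) eqxx.
Qed.

Lemma edge_value_pe v : on v -> edge_value (pe v) = arc_value (pv v).
Proof. by move=> ov; rewrite -(dc_ne_pv dc ov) edge_value_ne // (dc_on_pv dc). Qed.

Lemma edge_value_off e v : e \notin F -> v \in ends e ->
  edge_value e = if mu v == e then if mu (opp_end e v) == e then 4 else 2
                 else if mu (opp_end e v) == e then 2 else 1.
Proof.
move=> eF ve; rewrite /edge_value; case: pickP => [w /andP[ow /eqP ew]|_].
  by move: eF; rewrite -ew; case: (dc_ne dc ow) => ->.
have [ne0 _ ee] := opp_endP ve.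
rewrite /join_value ee big_setU1 ?big_set1 ?inE 1?eq_sym //=.
by case: (mu v == e); case: (mu _ == e).
Qed.

Lemma arc_value_bounds v : on v -> 0 < arc_value v <= 4.
Proof.
move=> ov; rewrite /arc_value; have := run3 ov; have := run3 (dc_on_pv dc ov); rewrite pvK.
move: (hooked (pv v)) (hooked v) (hooked (nx v)) (hooked (nx (nx v))) => h0 h1 h2 h3.
move: (c (pv v)) (c v) (c (nx v)) (c (nx (nx v))) => c0 c1 c2 c3.
by case: c0; case: c1; case: c2; case: c3; case: h0; case: h1; case: h2; case: h3.
Qed.

Lemma edge_value_bounds e : 0 < edge_value e <= 4.
Proof.
rewrite /edge_value; case: pickP => [v /andP[ov _]|_]; first exact: arc_value_bounds.
by rewrite /join_value; case: (_ == 0) => //; case: (_ == 1).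
Qed.

Lemma sum_minors v a b : v \in ends a -> v \in ends b -> a != b ->
  a != mu v -> b != mu v ->
  \sum_(e | (v \in ends e) && (e != mu v)) edge_value e = edge_value a + edge_value b.
Proof.
move=> va vb ab am bm; have [e3 [_ _ _ only]] := third_edge cubicG va vb ab.
have m3 : mu v = e3.
  by case: (only _ (mu_ends v)) => // e; [move: am | move: bm]; rewrite e eqxx.
rewrite (eq_bigl (mem [set a; b])) => [|e]; first by rewrite big_setU1 ?inE //= big_set1.
rewrite inE /= !inE; apply/andP/orP => [[ve em]|[]/eqP->//].
by case: (only e ve) => ee; [left|right|move: em]; rewrite ee ?eqxx // -m3 eqxx.
Qed.

Lemma minors_on v : on v ->
  \sum_(e | (v \in ends e) && (e != mu v)) edge_value e <= edge_value (mu v).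
Proof.
move=> ov; have [neF vne] := dc_ne dc ov; have [peF vpe] := dc_pe dc ov.
have [jF vj] := dc_je dc ov; have nepe := dc_neq dc ov.
have jm : (mu v == je v) = false.
  by apply/negbTE; apply: contraNneq jF => <-; apply: mu_on_F.
have jne : je v != ne v by apply: contraNneq jF => ->.
have jpe : je v != pe v by apply: contraNneq jF => ->.
have jval : edge_value (je v) = 1 + hooked v.
  by rewrite (edge_value_off jF vj) jm -/(hooked v); case: (hooked v).
have opv := dc_on_pv dc ov; have oppv := dc_on_pv dc opv.
have r2 := run2 ov; have r3 := run3 ov; have r3p := run3 opv; have r4p := run4 opv.
have r2p := run2 opv; have r3pp := run3 oppv; have r4pp := run4 oppv.
rewrite !pvK in r3p r4p r2p r3pp r4pp.
have := mu_on ov; case cv: (c v) => mv.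
  rewrite (sum_minors vne vj) ?mv // 1?eq_sym // edge_value_ne // edge_value_pe // jval.
  rewrite /arc_value pvK cv; move: r2 r3 r3p r4p r2p {r3pp r4pp}; rewrite cv.
  (* Colours and hooks around [v] become independent boolean variables, restricted only by the run
     lemmas; this covers short cycles too, where some of these vertices coincide. *)
  move: (hooked (pv v)) (hooked v) (hooked (nx v)) (hooked (nx (nx v))) => h0 h1 h2 h3.
  move: (c (pv v)) (c (nx v)) (c (nx (nx v))) => c0 c2 c3.
  by case: c0; case: c2; case: c3; case: h0; case: h1; case: h2; case: h3.
rewrite (sum_minors vpe vj) ?mv // 1?eq_sym // edge_value_ne // edge_value_pe // jval.
rewrite /arc_value pvK cv; move: r2 r3 r3p r4p r2p r3pp r4pp; rewrite cv.
move: (hooked (pv (pv v))) (hooked (pv v)) (hooked v) (hooked (nx v)) (hooked (nx (nx v))).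
move=> g0 h0 h1 h2 h3.
move: (c (pv (pv v))) (c (pv v)) (c (nx v)) (c (nx (nx v))) => d0 c0 c2 c3.
by case: d0; case: c0; case: c2; case: c3; case: g0; case: h0; case: h1; case: h2; case: h3.
Qed.

Lemma minors_off v : ~~ on v ->
  \sum_(e | (v \in ends e) && (e != mu v)) edge_value e <= edge_value (mu v).
Proof.
move=> ov; have vm := mu_ends v.
have := cubicG v; rewrite /degree (cardsD1 (mu v)) inE vm => -[/eqP/cards2P[a [b [ab /setP eab]]]].
have := eab a; have := eab b; rewrite !inE !eqxx orbT /= => /andP[bm vb] /andP[am va].
rewrite (sum_minors va vb ab am bm).
rewrite (edge_value_off (off_F ov va) va) (edge_value_off (off_F ov vb) vb).
rewrite (edge_value_off (off_F ov vm) vm) eqxx ![mu v == _]eq_sym (negbTE am) (negbTE bm).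
case: (boolP (mu (opp_end (mu v) v) == mu v)) => nd.
  by case: ifP; case: ifP.
by rewrite (negbTE (mu_unhooked ov va am nd)) (negbTE (mu_unhooked ov vb bm nd)).
Qed.

End Major.

Lemma major_edges_of_pairing : exists (mu : V -> E) (col : V -> bool) (g : E -> nat),
  [/\ forall v, v \in ends (mu v), forall e, 0 < g e <= 4,
      forall v, \sum_(e | (v \in ends e) && (e != mu v)) g e <= g (mu v)
    & forall e v, v \in ends e -> ~~ bridge e ->
        (col v (+) (mu v == e)) (+) (col (opp_end e v) (+) (mu (opp_end e v) == e))].
Proof.
have [mu0 mu0P] : exists mu0 : V -> E, forall v, if on v then mu0 v = if c v then pe v else ne v
    else v \in ends (mu0 v) /\ off_choice v (mu0 v).
  apply: (@fin_all_exists V (fun=> E) (fun v e => if on v then e = if c v then pe v else ne v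
    else v \in ends e /\ off_choice v e)) => v.
  by have [ov|ov] := boolP (on v); [exists (if c v then pe v else ne v) | exact: off_choice_exists].
have mu_on v : on v -> mu0 v = if c v then pe v else ne v by move=> ov; have := mu0P v; rewrite ov.
have mu_off v : ~~ on v -> v \in ends (mu0 v) /\ off_choice v (mu0 v).
  by move=> ov; have := mu0P v; rewrite (negbTE ov).
exists mu0, (final_colour mu0), (edge_value mu0); split.
- exact: mu_ends.
- exact: edge_value_bounds.
- by move=> v; have [ov|ov] := boolP (on v); [exact: minors_on | exact: minors_off].
- exact: final_colour_nb.
Qed.

End Choice.
End MajorEdgeChoice.

Lemma major_edges_exist : exists (mu : V -> E) (col : V -> bool) (g : E -> nat),
  [/\ forall v, v \in ends (mu v), forall e, 0 < g e <= 4,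
      forall v, \sum_(e | (v \in ends e) && (e != mu v)) g e <= g (mu v)
    & forall e v, v \in ends e -> ~~ bridge e ->
        (col v (+) (mu v == e)) (+) (col (opp_end e v) (+) (mu (opp_end e v) == e))].
Proof.
have [y [yP tame]] := admissible_tame.
have [chi [chi1 chi2 chi3]] := hooks_exist y.
have [M MP Mmax] := maximal_pairing y.
exact: (major_edges_of_pairing yP tame chi1 chi2 chi3 MP Mmax).
Qed.

End Labellings.

Local Open Scope ring_scope.

Theorem theorem22 (R : realType) (G : mgraph) (cubicG : cubic G) :
  admits_bounded_excess_flow G (7 / 2 : R) (1 / 2 : R).
Proof.
have [F [F_nb F_cover]] := cycle_cover cubicG.
have [nx [pv [ne [pe [je dc]]]]] := directed_cycles_exist cubicG (F_on F_cover).
have [mu [c [g [muP gP minors signs]]]] := major_edges_exist cubicG F_nb F_cover dc.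
exact: flow_of_major_edges cubicG muP gP minors signs.
Qed.
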